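(* Let $p\in[1,\infty]$, let $T:F\to E$ be a bounded linear operator between Banach spaces and let $\overline T:\mathrm{FBL}^{(p)}[F]\to \mathrm{FBL}^{(p)}[E]$ be the unique lattice homomorphism with $\overline T\phi_F=\phi_E T$. Then: (1) $T$ is injective if and only if $\overline T$ is injective. (2) $T$ has dense range if and only if $\overline T$ has dense range. (3) $T$ is onto if and only if $\overline T$ is onto.
   Context: Banach spaces are real. $H[E]$ is the vector lattice (pointwise operations) of positively homogeneous functions $f:E^*\to\mathbb R$. For $1\le p<\infty$ put $\|f\|_{\mathrm{FBL}^{(p)}[E]}=\sup\{(\sum_{k=1}^n|f(x_k^* )|^p)^{1/p}: n\in\mathbb N,\ x_1^*,\dots,x_n^*\in E^*,\ \sup_{x\in B_E}\sum_{k=1}^n|x_k^*(x)|^p\le 1\}$, and for $p=\infty$ put $\|f\|_{\mathrm{FBL}^{(\infty)}[E]}=\sup_{x^*\in B_{E^*}}|f(x^* )|$. For $x\in E$ let $\delta_x(x^* )=x^*(x)$. $\mathrm{FBL}^{(p)}[E]$ is the closure, in the space of $f\in H[E]$ with finite norm, of the sublattice generated by $\{\delta_x:x\in E\}$; $\phi_E:E\to\mathrm{FBL}^{(p)}[E]$, $\phi_E(x)=\delta_x$, is a linear isometric embedding. Universal property: for every $p$-convex Banach lattice $X$ with $p$-convexity constant $M^{(p)}(X)$ and every bounded linear $T:E\to X$ there is a unique lattice homomorphism $\widehat T:\mathrm{FBL}^{(p)}[E]\to X$ with $\widehat T\phi_E=T$, and $\|\widehat T\|\le M^{(p)}(X)\|T\|$.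 $\overline T$ is $\widehat{\phi_E T}$. *)

(* Defs.v *)
From HB Require Import structures.
From mathcomp Require Import all_boot all_order all_algebra.
From mathcomp Require Import all_classical all_reals all_analysis.
Set Implicit Arguments.
Unset Strict Implicit.
Unset Printing Implicit Defensive.
Import Order.TTheory GRing.Theory Num.Theory.
Import numFieldNormedType.Exports.
Local Open Scope classical_set_scope.
Local Open Scope ring_scope.

Section Dual.
Context {R : realType} (E : normedModType R).

Definition dual_pred : {pred E -> R} :=
  fun f => `[< scalar f /\ continuous f >].

Fact dual_pred_submod : submod_closed dual_pred.
Proof.
split=> [|a f g /asboolP[lf cf] /asboolP[lg cg]]; apply/asboolP.
  split=> [b u v|x]; last exact: cst_continuous.
  by rewrite /= mulr0 addr0.
split=> [b u v|x].
  rewrite !fctE /= lf lg !scalerDr mulrDr addrACA; congr (_ + _ + _).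
  by rewrite mulrCA.
by apply: (@continuousD _ _ _ (a \*: f) g) (cg x); apply: continuousZl_tmp; apply: cf.
Qed.

HB.instance Definition _ := GRing.isSubmodClosed.Build R (E -> R) dual_pred
  dual_pred_submod.

Record dual_space : Type :=
  Dual { dual_fun :> E -> R; dual_funP : dual_fun \in dual_pred }.

HB.instance Definition _ := [isSub for dual_fun].
HB.instance Definition _ := [Choice of dual_space by <:].
HB.instance Definition _ := [SubChoice_isSubLmodule of dual_space by <:].

Definition unit_ball : set E := [set v | `|v| <= 1].

Definition dual_norm (x : dual_space) : \bar R :=
  ereal_sup [set `|x v|%:E | v in unit_ball].

(* Membership in H[E]. *)
Definition pos_homogeneous (f : dual_space -> R) : Prop :=
  forall (a : R) (x : dual_space), 0 <= a -> f (a *: x) = a * f x.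

End Dual.

Section FreeBanachLattice.
Context {R : realType} (E : normedModType R).

Definition weak_p_sum (r : R) (n : nat) (x : 'I_n -> dual_space E) : \bar R :=
  ereal_sup [set (\sum_(k < n) `|x k v| `^ r)%:E | v in @unit_ball R E].

(* The value at p = -oo is a placeholder: only 1 <= p is meaningful. *)
Definition fbl_norm (p : \bar R) (f : dual_space E -> R) : \bar R :=
  match p with
  | r%:E => ereal_sup [set y | exists (n : nat) (x : 'I_n -> dual_space E),
      (weak_p_sum r x <= 1)%E /\
      y = ((\sum_(k < n) `|f (x k)| `^ r) `^ r^-1)%:E]
  | +oo%E => ereal_sup [set `|f x|%:E | x in [set x | (dual_norm x <= 1)%E]]
  | -oo%E => 0%E
  end.

(* Closure of A in the space of functions in H[E] with finite norm. *)
Definition fbl_closure (p : \bar R) (A : set (dual_space E -> R)) :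
    set (dual_space E -> R) :=
  [set f | [/\ pos_homogeneous f, (fbl_norm p f < +oo)%E &
    forall e : R, 0 < e ->
      exists2 g, A g & (fbl_norm p (f - g)%R < e%:E)%E]].

Definition delta (v : E) : dual_space E -> R := fun x => x v.

End FreeBanachLattice.

Definition sublattice {R : realType} {X : Type} (L : set (X -> R)) : Prop :=
  [/\ L 0,
      forall (a : R) (f g : X -> R), L f -> L g -> L (a *: f + g),
      forall f g : X -> R, L f -> L g -> L (f \max g) &
      forall f g : X -> R, L f -> L g -> L (f \min g)].

(* A lattice homomorphism between two vector lattices A and B of real functions
   with pointwise operations; the values of Phi outside A are irrelevant. *)
Record lattice_hom {R : realType} {X Y : Type}
    (A : set (X -> R)) (B : set (Y -> R)) (Phi : (X -> R) -> (Y -> R)) :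
    Prop := LatticeHom {
  lattice_hom_fun : set_fun A B Phi;
  lattice_hom_linear : forall (a : R) (f g : X -> R), A f -> A g ->
    Phi (a *: f + g) = a *: Phi f + Phi g;
  lattice_hom_max : forall f g : X -> R, A f -> A g ->
    Phi (f \max g) = Phi f \max Phi g;
  lattice_hom_min : forall f g : X -> R, A f -> A g ->
    Phi (f \min g) = Phi f \min Phi g }.

Definition FBL {R : realType} (p : \bar R) (E : normedModType R) :
    set (dual_space E -> R) :=
  fbl_closure p (smallest sublattice (range (@delta R E))).
Arguments FBL {R} p E.

(* Main.v *)
Require Import Defs.
From HB Require Import structures.
From mathcomp Require Import all_boot all_order all_algebra.
From mathcomp Require Import all_classical all_reals all_analysis.
From mathcomp Require Import ring lra.
Import Order.TTheory GRing.Theory Num.Theory.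
Import numFieldNormedType.Exports.
Local Open Scope classical_set_scope.
Local Open Scope ring_scope.
Set Implicit Arguments.
Unset Strict Implicit.
Unset Printing Implicit Defensive.

(** The key fact is that [Tbar f] is [f \o T^*] for every [f] in the free Banach
lattice: this holds on the sublattice generated by the [delta x], and every [f] is a
relatively uniform limit of elements of that sublattice.

(1) If [T] is injective and [f \o T^* = 0], Zorn's lemma gives a maximal subspace [V]
of the dual of [F] containing the range of [T^*] on which [f] vanishes.  As [f] is
weak-star continuous on bounded sets, [V] contains every functional dominated by a
multiple of the seminorm [q z = sup {|v z| : v in V, |v| <= 1}].  By Hahn-Banach and
successive approximation this forces [q] to be equivalent to the norm (the
Krein-Smulian argument), so [V] is the whole dual and [f = 0].

(2) The closure of the image of [Tbar] is a sublattice, and Hahn-Banach separates a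
point from the closure of the range of [T].

(3) If [Tbar] is onto, Banach-Steinhaus shows that [T^*] is bounded below, so [T] is
onto.  Conversely let [T] be onto, and lift [g] in the free vector lattice over [E] to
[f] over [F] by lifting the generators.  Truncating [|f|] by [sum |delta z|], for
finitely many [z] in the kernel of [T], does not change [f \o T^*].  For a suitable
choice of the [z] the norm of the truncation is at most a constant times the norm of
[g] (plus epsilon): otherwise there are tuples of functionals, almost vanishing on the
kernel, on which [f] is too large; since [f] depends on finitely many vectors these
can be merged into tuples of a fixed length, and a weak-star cluster point is a tuple
in the range of [T^*] contradicting the norm of [g].  Summing a series of such lifts
treats all of the free Banach lattice. *)

(** * Sublinear functionals and the Hahn-Banach theorem *)

Section Functionals.
Context {R : realType} {V : lmodType R}.
Implicit Types (phi : V -> R) (q : V -> R).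

Let scalar_pack phi (lphi : scalar phi) : {scalar V} :=
  HB.pack phi (GRing.isLinear.Build _ _ _ _ _ lphi).

Lemma scalar0 phi : scalar phi -> phi 0 = 0.
Proof. by move=> h; exact: (raddf0 (scalar_pack h)). Qed.

Lemma scalarD phi : scalar phi -> {morph phi : x y / x + y}.
Proof. by move=> h; exact: (raddfD (scalar_pack h)). Qed.

Lemma scalarN phi : scalar phi -> {morph phi : x / - x}.
Proof. by move=> h; exact: (raddfN (scalar_pack h)). Qed.

Lemma scalarB phi : scalar phi -> {morph phi : x y / x - y}.
Proof. by move=> h; exact: (raddfB (scalar_pack h)). Qed.

Lemma scalarZr phi : scalar phi -> forall a x, phi (a *: x) = a * phi x.
Proof. by move=> h a x; have := h a x 0; rewrite !addr0 (scalar0 h) addr0. Qed.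

Definition sublinear q :=
  (forall x y, q (x + y) <= q x + q y) /\
  (forall t x, 0 <= t -> q (t *: x) = t * q x).

Definition seminorm q :=
  (forall x y, q (x + y) <= q x + q y) /\
  (forall t x, q (t *: x) = `|t| * q x).

Lemma seminorm_sublinear {q} : seminorm q -> sublinear q.
Proof. by case=> qD qZ; split=> // t x t0; rewrite qZ ger0_norm. Qed.

Lemma sublinear0 {q} : sublinear q -> q 0 = 0.
Proof. by case=> _ qZ; rewrite -(scale0r 0) qZ// mul0r. Qed.

Lemma sublinear_opp_le {q} : sublinear q -> forall x, - q (- x) <= q x.
Proof.
move=> qs x; have := qs.1 x (- x); rewrite subrr (sublinear0 qs).
by rewrite -lerBlDr sub0r.
Qed.

Lemma seminorm0 {q} : seminorm q -> q 0 = 0.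
Proof. by move=> /seminorm_sublinear/sublinear0. Qed.

Lemma seminormN {q} : seminorm q -> forall x, q (- x) = q x.
Proof. by case=> _ qZ x; rewrite -scaleN1r qZ normrN1 mul1r. Qed.

Lemma seminorm_ge0 {q} : seminorm q -> forall x, 0 <= q x.
Proof.
move=> qs x; have := sublinear_opp_le (seminorm_sublinear qs) x.
by rewrite (seminormN qs); lra.
Qed.

(** A sublinear minorant of [q]. Taking [t = 1] at [- y] shows that every linear functional below it
    is at most [- q y] at [- y]. *)
Definition directional q y x := inf [set q (x + t *: y) - t * q y | t in [set t | 0 <= t]].

Lemma directional_lb q y x : sublinear q ->
  lbound [set q (x + t *: y) - t * q y | t in [set t | 0 <= t]] (- q (- x)).
Proof.
move=> qs _ [t /= t0 <-].
have := qs.1 (x + t *: y) (- x).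
by rewrite addrAC subrr add0r qs.2//; lra.
Qed.

Lemma directional_le q y x t : sublinear q -> 0 <= t ->
  directional q y x <= q (x + t *: y) - t * q y.
Proof.
move=> qs t0; apply: ge_inf; last by exists t.
by exists (- q (- x)); exact: directional_lb.
Qed.

Lemma directional_ge q y x c :
  (forall t, 0 <= t -> c <= q (x + t *: y) - t * q y) -> c <= directional q y x.
Proof.
move=> h; apply: lb_le_inf; first by exists (q (x + 0 *: y) - 0 * q y), 0 => /=.
by move=> _ [t /= t0 <-]; exact: h.
Qed.

Lemma directional_le_self q y : sublinear q -> forall x, directional q y x <= q x.
Proof.
move=> qs x; have := directional_le y x qs (lexx _).
by rewrite scale0r addr0 mul0r subr0.
Qed.

Lemma directional_sublinear q y : sublinear q -> sublinear (directional q y).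
Proof.
(* One inequality comes from replacing [t] by [s * t]; the reverse one is the same inequality for
   [s^-1]. *)
move=> qs; have homo_le s x : 0 < s -> directional q y (s *: x) <= s * directional q y x.
  move=> s0; rewrite mulrC -ler_pdivrMr//; apply: directional_ge => t t0.
  rewrite ler_pdivrMr//.
  have st0 : 0 <= s * t by rewrite mulr_ge0// ltW.
  have := directional_le y (s *: x) qs st0.
  by rewrite -scalerA -scalerDr qs.2 ?(ltW s0)//; lra.
split=> [x x'|s x].
  rewrite -lerBlDr; apply: directional_ge => t t0.
  rewrite lerBlDr -lerBlDl; apply: directional_ge => t' t'0.
  have := directional_le y (x + x') qs (addr_ge0 t0 t'0).
  have := qs.1 (x + t *: y) (x' + t' *: y).
  by rewrite addrACA -scalerDl; lra.
rewrite le_eqVlt => /predU1P[<-|s0].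
  rewrite scale0r mul0r; apply/le_anti/andP; split.
    by rewrite (le_trans (directional_le_self y qs 0))// (sublinear0 qs).
  by apply: directional_ge => t t0; rewrite add0r qs.2// subrr.
apply/le_anti; rewrite homo_le//=.
have := homo_le s^-1 (s *: x); rewrite invr_gt0 scalerA mulVf ?gt_eqF// scale1r.
by move=> /(_ s0); rewrite mulrC ler_pdivlMr// mulrC.
Qed.

(* Zorn on the sublinear functionals below [q], ordered by reversed domination:
   the infimum of a chain is sublinear, being bounded below by [- q (- x)]. *)
Lemma minimal_sublinear q : sublinear q ->
  exists m, [/\ sublinear m, forall x, m x <= q x &
    forall m', sublinear m' -> (forall x, m' x <= m x) -> m' = m].
Proof.
move=> qs.
pose T := {m : V -> R | sublinear m /\ forall x, m x <= q x}.
pose le (a b : T) := `[< forall x, sval b x <= sval a x >].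
have chain (A : set T) : total_on A le -> exists t, forall s, A s -> le s t.
  move=> Atot.
  have [A0|/set0P[a0 Aa0]] := eqVneq A set0; last first.
    pose m x := inf [set sval a x | a in A].
    have lbm x : lbound [set sval a x | a in A] (- q (- x)).
      move=> _ [[a [as_ aq]] Aa <-] /=.
      by have := sublinear_opp_le as_ x; have := aq (- x); lra.
    have m_le a x : A a -> m x <= sval a x.
      by move=> Aa; apply: ge_inf; [exists (- q (- x)) | exists a].
    have le_m x c : (forall a, A a -> c <= sval a x) -> c <= m x.
      move=> h; apply: lb_le_inf; first by exists (sval a0 x), a0.
      by move=> _ [a Aa <-]; exact: h.
    have ms : sublinear m.
      split=> [x y|t x t0].
        rewrite -lerBlDr; apply: (le_m) => a Aa.
        rewrite lerBlDr -lerBlDl; apply: (le_m) => b Ab.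
        have [/asboolP ab|/asboolP ba] := Atot _ _ Aa Ab.
          have := m_le _ (x + y) Ab; have := (svalP b).1.1 x y.
          by have := ab x; lra.
        have := m_le _ (x + y) Aa; have := (svalP a).1.1 x y.
        by have := ba y; lra.
      apply/le_anti/andP; split; last first.
        apply: (le_m) => a Aa; rewrite (svalP a).1.2// ler_wpM2l//.
        exact: m_le.
      have /predU1P[<-|{}t0] : (0 == t) || (0 < t) by rewrite -le_eqVlt.
        by rewrite mul0r (le_trans (m_le _ _ Aa0))// (svalP a0).1.2// mul0r.
      rewrite mulrC -ler_pdivrMr//; apply: (le_m) => a Aa.
      rewrite ler_pdivrMr// mulrC -(svalP a).1.2 ?(ltW t0)//.
      exact: m_le.
    have mq x : m x <= q x := le_trans (m_le _ x Aa0) ((svalP a0).2 x).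
    exists (exist _ m (conj ms mq)) => a Aa; apply/asboolP => x /=.
    exact: m_le.
  by exists (exist _ q (conj qs (fun x => lexx _))) => s; rewrite A0.
have [|||[m [ms mq]] mmin] := @Zorn T le _ _ _ chain.
- by move=> a; apply/asboolP.
- move=> a b c /asboolP ab /asboolP bc; apply/asboolP => x.
  exact: le_trans (bc x) (ab x).
- move=> [a pa] [b pb] /asboolP/= ab /asboolP/= ba.
  apply: eq_exist; apply/funext => x; apply/le_anti.
  by rewrite ab ba.
- exists m; split=> // m' m's m'm.
  have m'q x : m' x <= q x := le_trans (m'm x) (mq x).
  have := mmin (exist _ m' (conj m's m'q)) => /=.
  by move=> /(_ (asboolT m'm)) [].
Qed.

(** A minimal sublinear [m] coincides with each of its minorants [directional m y]. The case [t = 1]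
    then reads [m x + m y <= m (x + y)], so [m] is additive. *)
Lemma sublinear_dominates_scalar q : sublinear q ->
  exists2 phi, scalar phi & forall x, phi x <= q x.
Proof.
move=> /minimal_sublinear[m [ms mq mmin]]; exists m => //.
have dirE y : directional m y = m.
  apply: mmin; first exact: directional_sublinear.
  exact: directional_le_self.
have mD x y : m (x + y) = m x + m y.
  apply/le_anti; rewrite ms.1/=.
  have := directional_le y x ms ler01; rewrite dirE scale1r mul1r.
  by lra.
have mN x : m (- x) = - m x.
  by have := mD x (- x); rewrite subrr (sublinear0 ms); lra.
move=> a x y; rewrite mD; congr (_ + _).
have [a0|a0] := leP 0 a; first exact: ms.2.
by rewrite -[a]opprK scaleNr mN ms.2 ?mulNr// oppr_ge0 ltW.
Qed.

(** A linear functional below [directional q x0] is below [q], and its value at [- x0] is at most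
    [- q x0]; this forces equality at [x0]. *)
Lemma Hahn_Banach q x0 : seminorm q ->
  exists phi, [/\ scalar phi, forall x, `|phi x| <= q x & phi x0 = q x0].
Proof.
move=> qs; have sq := seminorm_sublinear qs.
have [phi lphi phi_le] := sublinear_dominates_scalar (directional_sublinear x0 sq).
have phiq x : phi x <= q x := le_trans (phi_le x) (directional_le_self x0 sq x).
exists phi; split=> //.
  move=> x; rewrite ler_norml phiq andbT lerNl -(scalarN lphi).
  by rewrite -(seminormN qs x).
apply/le_anti; rewrite phiq/=.
have := phi_le (- x0); have := directional_le x0 (- x0) sq ler01.
rewrite scale1r addNr (seminorm0 qs) mul1r (scalarN lphi).
by lra.
Qed.

End Functionals.

(** * Infimal convolution of seminorms along a linear map *)

Section InfConvolution.
Context {R : realType} {F E : lmodType R} (T : {linear F -> E}).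
Variables (p : F -> R) (q : E -> R).
Hypotheses (ps : seminorm p) (qs : seminorm q).

(** The largest seminorm that is below [q] and whose composite with [T] is below [p]. For [p = 0] it
    is the [q]-distance to the range of [T]. *)
Definition infconv (y : E) : R := inf (range (fun x => p x + q (y - T x))).

Lemma infconv_le y x : infconv y <= p x + q (y - T x).
Proof.
apply: ge_inf; last by exists x.
by exists 0 => _ [z _ <-]; rewrite addr_ge0// seminorm_ge0.
Qed.

Lemma infconv_ge y c : (forall x, c <= p x + q (y - T x)) -> c <= infconv y.
Proof.
move=> h; apply: lb_le_inf; first by exists (p 0 + q (y - T 0)), 0.
by move=> _ [z _ <-].
Qed.

Lemma infconv_adherent y e : 0 < e -> exists x, p x + q (y - T x) < infconv y + e.
Proof.
move=> e0; apply: contrapT => /forallNP h.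
have : infconv y + e <= infconv y.
  by apply: infconv_ge => x; rewrite leNgt; apply/negP/h.
by lra.
Qed.

Lemma infconv_seminorm : seminorm infconv.
Proof.
have homo_le t y : t != 0 -> infconv (t *: y) <= `|t| * infconv y.
  move=> t0; rewrite mulrC -ler_pdivrMr ?normr_gt0//; apply: infconv_ge => x.
  rewrite ler_pdivrMr ?normr_gt0// mulrC mulrDr -ps.2 -qs.2 scalerBr -linearZ.
  exact: infconv_le.
split=> [x y|t y].
  rewrite -lerBlDr; apply: infconv_ge => u.
  rewrite lerBlDr -lerBlDl; apply: infconv_ge => v.
  have := infconv_le (x + y) (u + v).
  rewrite linearD opprD addrACA.
  by have := ps.1 u v; have := qs.1 (x - T u) (y - T v); lra.
have [->|t0] := eqVneq t 0.
  rewrite normr0 mul0r scale0r; apply/le_anti/andP; split.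
    by have := infconv_le 0 0; rewrite linear0 subr0 (seminorm0 ps) (seminorm0 qs) addr0.
  by apply: infconv_ge => x; rewrite addr_ge0// seminorm_ge0.
apply/le_anti; rewrite homo_le//=.
have := homo_le t^-1 (t *: y); rewrite invr_eq0 scalerA mulVf// scale1r normfV => /(_ t0).
by rewrite mulrC ler_pdivlMr ?normr_gt0// mulrC.
Qed.

End InfConvolution.

(** * Solving [T x = y] by duality and successive approximation *)

Section Solvability.
Context {R : realType}.

(** A functional norming [y] for the infimal convolution of [p] and [N * q] satisfies the premises
    on [phi], so the convolution is at most [C * q y] at [y]. A near-minimiser [x] in its definition
    is the required approximate solution. *)
Lemma approx_solvable {F E : lmodType R} (T : {linear F -> E}) (p : F -> R)
    (q : E -> R) (C : R) : seminorm p -> seminorm q ->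
  (forall (phi : E -> R) (N : R), scalar phi -> 0 <= N ->
    (forall y, `|phi y| <= N * q y) -> (forall x, `|phi (T x)| <= p x) ->
    forall y, `|phi y| <= C * q y) ->
  forall y (e : R), 0 < e -> exists x, p x <= C * q y + e /\ q (y - T x) <= e.
Proof.
move=> ps qs H y e e0.
have q0 := seminorm_ge0 qs; have p0 := seminorm_ge0 ps.
(* [N] is large enough that [N * q (y - T x) <= C * q y + e] implies [q (y - T x) <= e]. *)
pose N := (`|C * q y| + e) / e.
have N0 : 0 < N by rewrite divr_gt0// ltr_wpDl.
have Nqs : seminorm (fun y => N * q y).
  split=> [u v|t u]; first by rewrite -mulrDr ler_wpM2l ?(ltW N0)// qs.1.
  by rewrite qs.2 mulrCA.
have [phi [lphi phi_le phi_y]] := Hahn_Banach y (infconv_seminorm T ps Nqs).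
have sy : infconv T p (fun y => N * q y) y <= C * q y.
  rewrite -phi_y (le_trans (ler_norm _))//; apply: (H phi N) => //.
  - exact: ltW.
  - move=> u; apply: (le_trans (phi_le u)).
    have := infconv_le T ps Nqs u 0.
    by rewrite (seminorm0 ps) add0r linear0 subr0.
  - move=> x; apply: (le_trans (phi_le _)).
    have := infconv_le T ps Nqs (T x) x.
    by rewrite subrr (seminorm0 qs) mulr0 addr0.
have [x hx] := infconv_adherent T p (fun y => N * q y) y e0.
exists x; split.
  have : 0 <= N * q (y - T x) by rewrite mulr_ge0// ltW.
  by lra.
have : N * q (y - T x) <= C * q y + e by have := p0 x; lra.
rewrite mulrAC ler_pdivrMr// => h.
have : (`|C * q y| + e) * q (y - T x) <= (`|C * q y| + e) * e.
  by rewrite (le_trans h)// ler_wpM2r ?(ltW e0)// lerD2r ler_norm.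
by rewrite ler_pM2l// ltr_wpDl.
Qed.

Lemma sum_half_pow (n : nat) : \sum_(i < n) (2^-1 : R) ^+ i <= 2.
Proof.
suff -> : \sum_(i < n) (2^-1 : R) ^+ i = 2 - 2 * 2^-1 ^+ n.
  by rewrite gerBl mulr_ge0// exprn_ge0// invr_ge0.
elim: n => [|n IH]; first by rewrite big_ord0 expr0; lra.
by rewrite big_ord_recr/= IH exprS; lra.
Qed.

Lemma half_pow_small (d e : R) : 0 < e -> \forall n \near \oo, d * 2^-1 ^+ n <= e.
Proof.
move=> e0; have h : (d * 2^-1 ^+ n) @[n --> \oo] --> (d * 0 : R).
  apply: cvgMr; apply: cvg_expr.
  by rewrite ger0_norm ?invr_ge0// invf_lt1// ltr1n.
move: h; rewrite mulr0 => /cvgrPdist_le/(_ e e0); apply: filterS => n.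
by rewrite sub0r normrN => /(le_trans (ler_norm _)).
Qed.

Lemma norm_bounded_series_cvg {V : completeNormedModType R} (u : nat -> V) (M : R) :
  (forall n, \sum_(i < n) `|u i| <= M) ->
  exists2 l, `|l| <= M & (\sum_(i < n) u i) @[n --> \oo] --> l.
Proof.
move=> uM.
have cu : cvgn (series u).
  apply: normed_cvg; apply: nondecreasing_is_cvgn.
    by apply: nondecreasing_series => n _ _; exact: normr_ge0.
  by exists M => _ [n _ <-]; rewrite /= /series/= big_mkord.
exists (limn (series u)).
  have /cvg_norm h : series u @ \oo --> limn (series u) := cu.
  rewrite -(cvg_lim (@norm_hausdorff _ _) h).
  apply: limr_le; first exact: is_cvg_norm.
  apply: nearW => n; rewrite /series/= big_mkord.
  exact: le_trans (ler_norm_sum _ _ _) (uM n).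
have -> : (fun n => \sum_(i < n) u i) = series u.
  by apply/funext => n; rewrite /series/= big_mkord.
exact: cu.
Qed.

(** Approximate solutions for the successive residuals form an absolutely convergent series. The
    residual vanishes only in the sense of [q], which is merely a seminorm. *)
Lemma exact_solvable {F : completeNormedModType R} {E : lmodType R}
    (T : {linear F -> E}) (q : E -> R) (C M : R) : seminorm q -> 0 <= C ->
  (forall x, q (T x) <= M * `|x|) ->
  (forall y (e : R), 0 < e -> exists x, `|x| <= C * q y + e /\ q (y - T x) <= e) ->
  forall y (e : R), 0 < e -> exists x, `|x| <= C * q y + e /\ q (y - T x) = 0.
Proof.
move=> qs C0 qT H y e e0.
(* The first correction exceeds [C * q y] by at most [d], and all later ones together cost at most
   [2 * (C + 1) * d]; the sum of these two amounts is [e]. *)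
pose d := e / (2 * (C + 1) + 1).
have d0 : 0 < d by rewrite divr_gt0//; lra.
pose ep n : R := d * 2^-1 ^+ n.
have ep0 n : 0 < ep n by rewrite mulr_gt0// exprn_gt0// invr_gt0.
pose solve y n := sval (cid (H y (ep n) (ep0 n))).
have solveP y' n : `|solve y' n| <= C * q y' + ep n /\ q (y' - T (solve y' n)) <= ep n.
  by rewrite /solve; case: cid.
pose r := fix r n := if n is n.+1 then r n - T (solve (r n) n) else y.
pose x n := solve (r n) n.
have rE n : r n = y - T (\sum_(i < n) x i).
  elim: n => [|n IH]; first by rewrite big_ord0 linear0 subr0.
  by rewrite big_ord_recr/= linearD opprD addrA -IH.
have qr n : q (r n.+1) <= ep n by exact: (solveP _ _).2.
have xS n : `|x n.+1| <= (C + 1) * ep n.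
  apply: (le_trans (solveP _ _).1); rewrite mulrDl mul1r lerD//.
    by rewrite ler_wpM2l.
  by rewrite /ep exprS mulrCA ler_piMl ?(ltW (ep0 n))//; lra.
have [|l l_le Sl] := @norm_bounded_series_cvg _ x (C * q y + e).
  case=> [|n].
    by rewrite big_ord0 addr_ge0 ?(ltW e0)// mulr_ge0// seminorm_ge0.
  rewrite big_ord_recl/=.
  have x0 : `|x 0%N| <= C * q y + d.
    by have := (solveP (r 0%N) 0%N).1; rewrite /ep expr0 mulr1.
  have : \sum_(i < n) `|x (bump 0 i)| <= (C + 1) * d * 2.
    apply: (@le_trans _ _ ((C + 1) * d * \sum_(i < n) 2^-1 ^+ i)); last first.
      by rewrite ler_wpM2l ?sum_half_pow// mulr_ge0// ?(ltW d0)//; lra.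
    by rewrite mulr_sumr; apply: ler_sum => i _; rewrite -mulrA; exact: xS.
  have : e = d * (2 * (C + 1) + 1) by rewrite /d divfK// gt_eqF//; lra.
  by lra.
exists l; split=> //; apply/le_anti; rewrite seminorm_ge0// andbT.
apply/ler_addgt0Pl => eta eta0; rewrite addr0.
have eta2 : 0 < eta / 2 by lra.
have h1 : \forall n \near \oo, ep n <= eta / 2 by exact: half_pow_small.
have h2 : \forall n \near \oo, `|M| * `|\sum_(i < n.+1) x i - l| <= eta / 2.
  have : (`|M| * `|\sum_(i < n.+1) x i - l|) @[n --> \oo] --> `|M| * `|l - l|.
    apply: cvgMr; apply: cvg_norm; apply: cvgB; last exact: cvg_cst.
    by move: Sl; rewrite -(cvg_shiftS (fun n => \sum_(i < n) x i)).
  rewrite subrr normr0 mulr0 => /cvgrPdist_le/(_ _ eta2); apply: filterS => n.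
  by rewrite sub0r normrN => /(le_trans (ler_norm _)).
near \oo => n.
have -> : y - T l = r n.+1 + T (\sum_(i < n.+1) x i - l).
  by rewrite rE linearB addrA subrK.
apply: (le_trans (qs.1 _ _)); rewrite [leRHS](splitr eta) lerD//.
  by rewrite (le_trans (qr n))//; near: n.
rewrite (le_trans (qT _))//.
apply: (@le_trans _ _ (`|M| * `|\sum_(i < n.+1) x i - l|)).
  by rewrite ler_wpM2r// ler_norm.
by near: n.
Unshelve. all: by end_near. Qed.

End Solvability.

(** * The finite-dimensional l^p norms *)

(** The index set is an arbitrary finite type because merged tuples are indexed by cells rather than
    by an ordinal. *)
HB.lock Definition lpn {R : realType} (r : R) (I : finType) (a : I -> R) : R :=
  (\sum_i `|a i| `^ r) `^ r^-1.
Arguments lpn {R} r {I} a.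

Section Lp.
Context {R : realType} (r : R) (r1 : 1 <= r).

Let r0 : 0 < r. Proof. exact: lt_le_trans r1. Qed.
Let rn0 : r != 0. Proof. by rewrite gt_eqF. Qed.

Lemma powR_le (a b : R) : 0 <= a -> a <= b -> a `^ r <= b `^ r.
Proof.
by move=> a0 ab; rewrite ge0_ler_powR ?nnegrE ?(ltW r0)// (le_trans a0).
Qed.

Lemma powR_inv_le (a b : R) : 0 <= a -> a <= b -> a `^ r^-1 <= b `^ r^-1.
Proof.
move=> a0 ab; rewrite ge0_ler_powR ?nnegrE ?invr_ge0 ?(ltW r0)//.
exact: le_trans ab.
Qed.

Lemma powR_K (a : R) : 0 <= a -> (a `^ r) `^ r^-1 = a.
Proof. by move=> a0; rewrite -powRrM mulfV// powRr1. Qed.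

Lemma powR_invK (a : R) : 0 <= a -> (a `^ r^-1) `^ r = a.
Proof. by move=> a0; rewrite -powRrM mulVf// powRr1. Qed.

Lemma powR_div (a b : R) : 0 <= a -> 0 <= b -> (a / b) `^ r = a `^ r / b `^ r.
Proof.
move=> a0 b0; rewrite powRM ?invr_ge0//; congr (_ * _).
by rewrite -powR_inv1// -powRrM mulN1r powRN.
Qed.

Lemma powR_convex (t x y : R) : 0 <= t <= 1 -> 0 <= x -> 0 <= y ->
  (t * x + (1 - t) * y) `^ r <= t * x `^ r + (1 - t) * y `^ r.
Proof.
move=> /andP[t0 t1] x0 y0.
by apply: (convex_powR r1 (Itv01 t0 t1)) => //=; rewrite inE/= in_itv/= andbT.
Qed.

(* The perspective [(w, s) |-> w (s / w)^r] of the convex power function is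
   subadditive; when [w = s = 0] division by zero gives the intended value 0. *)
Lemma powR_perspective_sum (I : finType) (P : pred I) (w s : I -> R) :
  (forall i, P i -> 0 < w i) -> (forall i, P i -> 0 <= s i) ->
  (\sum_(i | P i) w i) * ((\sum_(i | P i) s i) / (\sum_(i | P i) w i)) `^ r
    <= \sum_(i | P i) w i * (s i / w i) `^ r.
Proof.
move=> w0 s0.
(* The induction also carries the signs of both sums and the fact that a zero total weight forces a
   zero numerator. *)
suff [] : [/\ 0 <= \sum_(i | P i) w i, 0 <= \sum_(i | P i) s i,
    (\sum_(i | P i) w i = 0 -> \sum_(i | P i) s i = 0) &
    (\sum_(i | P i) w i) * ((\sum_(i | P i) s i) / (\sum_(i | P i) w i)) `^ r
    <= \sum_(i | P i) w i * (s i / w i) `^ r] by [].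
elim/big_rec3: _ => [|i G S W Pi [W0 S0 WS IH]]; first by split; rewrite ?mul0r.
have wi := w0 i Pi; have si := s0 i Pi.
have wW : 0 < w i + W by rewrite ltr_wpDr.
split; [exact: ltW|exact: addr_ge0|by move=> h; move: wW; rewrite h ltxx|].
have [W00|Wn0] := eqVneq W 0.
  by rewrite W00 (WS W00) !addr0; move: IH; rewrite W00 mul0r; lra.
have Wp : 0 < W by rewrite lt_neqAle eq_sym Wn0.
pose t := w i / (w i + W).
have t01 : 0 <= t <= 1.
  by rewrite /t divr_ge0 ?(ltW wi) ?(ltW wW)//= ler_pdivrMr// mul1r lerDl.
have tE : 1 - t = W / (w i + W) by rewrite /t; field; rewrite gt_eqF.
have := powR_convex t01 (divr_ge0 si (ltW wi)) (divr_ge0 S0 W0).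
rewrite tE {1 2}/t.
have -> : w i / (w i + W) * (s i / w i) + W / (w i + W) * (S / W) = (s i + S) / (w i + W).
  by field; rewrite (gt_eqF wW) (gt_eqF Wp) (gt_eqF wi).
move=> h; rewrite mulrC -ler_pdivlMr// (le_trans h)// ler_pdivlMr// mulrDl.
have nW : w i + W != 0 by rewrite gt_eqF.
have -> : w i / (w i + W) * (s i / w i) `^ r * (w i + W) = w i * (s i / w i) `^ r.
  by field.
have -> : W / (w i + W) * (S / W) `^ r * (w i + W) = W * (S / W) `^ r by field.
by rewrite lerD2l.
Qed.


Section Lpn.
Context {I : finType}.
Local Notation lpn := (@lpn R r I).
Implicit Types a b : I -> R.

Let sum_ge0 a : 0 <= \sum_i `|a i| `^ r.
Proof. by apply: sumr_ge0 => i _; exact: powR_ge0. Qed.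

Lemma lpnE a : lpn a = (\sum_i `|a i| `^ r) `^ r^-1.
Proof. by rewrite lpn.unlock. Qed.

Lemma lpn_ge0 a : 0 <= lpn a. Proof. by rewrite lpnE powR_ge0. Qed.

Lemma lpn_leP a c : 0 <= c -> (lpn a <= c) = (\sum_i `|a i| `^ r <= c `^ r).
Proof.
move=> c0; apply/idP/idP => h.
  by rewrite -[leLHS]powR_invK// -lpnE powR_le// lpn_ge0.
by rewrite -[leRHS]powR_K// lpnE powR_inv_le.
Qed.

Lemma ler_lpn a b : (forall i, `|a i| <= `|b i|) -> lpn a <= lpn b.
Proof.
by move=> ab; rewrite !lpnE powR_inv_le//; apply: ler_sum => i _; exact: powR_le.
Qed.

Lemma lpn_ext a b : (forall i, `|a i| = `|b i|) -> lpn a = lpn b.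
Proof. by move=> ab; rewrite !lpnE; under eq_bigr do rewrite ab. Qed.

Lemma lpnZ c a : lpn (fun i => c * a i) = `|c| * lpn a.
Proof.
rewrite !lpnE; under eq_bigr do rewrite normrM powRM//.
by rewrite -mulr_sumr powRM ?powR_ge0// powR_K.
Qed.

Lemma lpn_coord a i : `|a i| <= lpn a.
Proof.
rewrite -[leLHS]powR_K// lpnE powR_inv_le ?powR_ge0// (bigD1 i)//= lerDl.
by apply: sumr_ge0 => j _; exact: powR_ge0.
Qed.

(** Minkowski's inequality: [|a i + b i| / (A + B)] is at most a convex combination of [|a i| / A]
    and [|b i| / B], and the power is convex. Strict upper bounds [A], [B] of the norms are used
    because they are positive. *)
Lemma lpnD a b : lpn (fun i => a i + b i) <= lpn a + lpn b.
Proof.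
suff h A B : lpn a < A -> lpn b < B -> lpn (fun i => a i + b i) <= A + B.
  apply/ler_addgt0Pl => e e0.
  have e2 : 0 < e / 2 by lra.
  by rewrite addrC [e]splitr addrACA; apply: h; rewrite ltrDl.
move=> aA bB.
have A0 : 0 < A := le_lt_trans (lpn_ge0 a) aA.
have B0 : 0 < B := le_lt_trans (lpn_ge0 b) bB.
have AB0 : 0 < A + B by rewrite addr_gt0.
have aAr : \sum_i `|a i| `^ r <= A `^ r by rewrite -lpn_leP ?ltW.
have bBr : \sum_i `|b i| `^ r <= B `^ r by rewrite -lpn_leP ?ltW.
rewrite lpn_leP ?(ltW AB0)//.
pose t := A / (A + B).
have t01 : 0 <= t <= 1.
  by rewrite /t divr_ge0 ?(ltW A0) ?(ltW AB0)//= ler_pdivrMr// mul1r lerDl ltW.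
have tE : 1 - t = B / (A + B) by rewrite /t; field; rewrite gt_eqF.
have Ar : 0 < A `^ r by rewrite powR_gt0.
have Br : 0 < B `^ r by rewrite powR_gt0.
have step i : `|a i + b i| `^ r <= (A + B) `^ r *
    (t * (`|a i| `^ r / A `^ r) + (1 - t) * (`|b i| `^ r / B `^ r)).
  rewrite -!powR_div ?(ltW A0) ?(ltW B0)//.
  have h := powR_convex t01
    (divr_ge0 (normr_ge0 (a i)) (ltW A0)) (divr_ge0 (normr_ge0 (b i)) (ltW B0)).
  apply: le_trans (ler_wpM2l (powR_ge0 _ _) h).
  rewrite -powRM ?(ltW AB0)//; last first.
    by rewrite tE addr_ge0// mulr_ge0// divr_ge0// ltW.
  apply: powR_le => //; rewrite tE /t.
  have -> : (A + B) * (A / (A + B) * (`|a i| / A) + B / (A + B) * (`|b i| / B)) = `|a i| + `|b i|.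
    by field; rewrite !gt_eqF.
  exact: ler_normD.
apply: (le_trans (ler_sum _ (fun i _ => step i))).
rewrite -mulr_sumr ler_piMr ?powR_ge0// big_split/= -!mulr_sumr -!mulr_suml.
apply: (@le_trans _ _ (t * 1 + (1 - t) * 1)); last by rewrite !mulr1 addrC subrK.
move/andP: t01 => [t0 t1].
by rewrite lerD// ler_wpM2l// ?subr_ge0// ler_pdivrMr// mul1r; [exact: aAr|exact: bBr].
Qed.

Lemma lpn_sum (J : Type) (s : seq J) (a : J -> I -> R) :
  lpn (fun i => \sum_(j <- s) a j i) <= \sum_(j <- s) lpn (a j).
Proof.
elim: s => [|j s IH].
  rewrite big_nil lpn_leP// powR0// big1// => i _.
  by rewrite big_nil normr0 powR0.
have -> : lpn (fun i => \sum_(j <- j :: s) a j i) = lpn (fun i => a j i + \sum_(j <- s) a j i).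
  by apply: lpn_ext => i; rewrite big_cons.
rewrite big_cons.
by rewrite (le_trans (lpnD _ _))// lerD2l.
Qed.

(** This passes norm bounds to pointwise limits of functions and to weak-star limits of tuples. *)
Lemma lpn_closed b c :
  (forall e : R, 0 < e -> exists2 a, lpn a <= c & forall i, `|b i - a i| <= e) ->
  lpn b <= c.
Proof.
move=> H; apply/ler_addgt0Pl => e e0.
pose K := lpn (fun=> 1).
have K0 : 0 <= K := lpn_ge0 _.
have d0 : 0 < e / (K + 1) by rewrite divr_gt0//; lra.
have [a ac ba] := H _ d0.
have -> : lpn b = lpn (fun i => (b i - a i) + a i).
  by apply: lpn_ext => i; rewrite subrK.
rewrite (le_trans (lpnD _ _))// lerD//.
apply: (@le_trans _ _ (lpn (fun i => e / (K + 1) * 1))).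
  by apply: ler_lpn => i; rewrite mulr1 (ger0_norm (ltW d0)).
rewrite lpnZ (ger0_norm (ltW d0)) mulrAC ler_pdivrMr; last by lra.
by rewrite ler_pM2l// -/K; lra.
Qed.

End Lpn.
End Lp.

(** * Dual spaces, sublattices and the free vector lattice *)

Section DualSpace.
Context {R : realType} {E : normedModType R}.
Implicit Types (x y : dual_space E) (v : E).

Lemma dual_scalar x : scalar x.
Proof. by case: x => f /= /asboolP[]. Qed.

Lemma dual_ext x y : (forall v, x v = y v) -> x = y.
Proof. by move=> xy; apply: val_inj; apply/funext. Qed.

Lemma dualDE x y v : (x + y) v = x v + y v. Proof. by []. Qed.
Lemma dualBE x y v : (x - y) v = x v - y v. Proof. by []. Qed.
Lemma dualZE (a : R) x v : (a *: x) v = a * x v. Proof. by []. Qed.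
Lemma dual0E v : (0 : dual_space E) v = 0. Proof. by []. Qed.

Lemma dual_sumE (I : Type) (s : seq I) (P : pred I) (x : I -> dual_space E) v :
  (\sum_(i <- s | P i) x i) v = \sum_(i <- s | P i) x i v.
Proof. by elim/big_rec2: _ => //= i a b _ <-. Qed.

Lemma continuous_scalar_bounded (phi : E -> R) : scalar phi -> continuous phi ->
  exists2 C, 0 < C & forall v, `|phi v| <= C * `|v|.
Proof.
move=> lphi cphi.
pose f : {linear E -> R^o} :=
  HB.pack (phi : E -> R^o) (GRing.isLinear.Build _ _ _ _ (phi : E -> R^o) lphi).
have /linear_boundedP : bounded_near f (nbhs (0 : E)).
  exact: (@continuous_linear_bounded R E R^o 0 f (cphi 0)).
by move=> /pinfty_ex_gt0[C C0 h]; exists C.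
Qed.

Lemma dual_bounded x : exists2 C, 0 < C & forall v, `|x v| <= C * `|v|.
Proof. by case: x => f /= /asboolP[lf cf]; exact: continuous_scalar_bounded. Qed.

Lemma bounded_scalar_dual (phi : E -> R) (C : R) :
  scalar phi -> (forall v, `|phi v| <= C * `|v|) ->
  exists x : dual_space E, forall v, x v = phi v.
Proof.
move=> lphi bphi.
pose f : {linear E -> R^o} :=
  HB.pack (phi : E -> R^o) (GRing.isLinear.Build _ _ _ _ (phi : E -> R^o) lphi).
have cphi : continuous phi.
  apply: (@bounded_linear_continuous R E R^o f); apply/linear_boundedP.
  apply: filterS (nbhs_pinfty_ge (num_real C)) => r Cr v.
  by rewrite (le_trans (bphi v))// ler_wpM2r.
have phiP : phi \in dual_pred (E := E) by apply/asboolP.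
by exists (Dual phiP).
Qed.

End DualSpace.

Section Adjoint.
Context {R : realType} {F E : normedModType R} (T : {linear F -> E}).
Hypothesis hT : continuous T.

Fact adjoint_subproof (y : dual_space E) : y \o T \in dual_pred (E := F).
Proof.
case: y => f /= /asboolP[lf cf]; apply/asboolP; split.
  by move=> a u v; rewrite /= linearP lf.
by move=> v; apply: continuous_comp; [exact: hT|exact: cf].
Qed.

Definition adjoint (y : dual_space E) : dual_space F := Dual (adjoint_subproof y).

Lemma adjointE y v : adjoint y v = y (T v). Proof. by []. Qed.

Lemma adjoint_linear : linear adjoint.
Proof. by move=> a x y; exact: dual_ext. Qed.

End Adjoint.

Section Sublattices.
Context {R : realType}.

Section Closure.
Context {X : Type} {L : set (X -> R)}.
Hypothesis hL : sublattice L.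

Lemma sublattice0 : L 0. Proof. by case: hL. Qed.

Lemma sublattice_lin (a : R) f g : L f -> L g -> L (a *: f + g).
Proof. by case: hL => _ + _ _; apply. Qed.

Lemma sublattice_max f g : L f -> L g -> L (f \max g).
Proof. by case: hL => _ _ + _; apply. Qed.

Lemma sublattice_min f g : L f -> L g -> L (f \min g).
Proof. by case: hL => _ _ _; apply. Qed.

Lemma sublatticeZ (a : R) f : L f -> L (a *: f).
Proof. by move=> Lf; rewrite -[_ *: _]addr0; exact: sublattice_lin sublattice0. Qed.

Lemma sublatticeD f g : L f -> L g -> L (f + g).
Proof. by move=> Lf Lg; rewrite -[f]scale1r; exact: sublattice_lin. Qed.

Lemma sublatticeN f : L f -> L (- f).
Proof. by move=> Lf; rewrite -scaleN1r; exact: sublatticeZ. Qed.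

Lemma sublatticeB f g : L f -> L g -> L (f - g).
Proof. by move=> Lf Lg; apply: sublatticeD => //; exact: sublatticeN. Qed.

Lemma sublattice_norm f : L f -> L (fun x => `|f x|).
Proof.
move=> Lf; have -> : (fun x => `|f x|) = f \max (- f).
  by apply/funext => x; rewrite /= maxrN.
by apply: sublattice_max => //; exact: sublatticeN.
Qed.

Lemma sublattice_sum (I : Type) (s : seq I) (f : I -> X -> R) :
  (forall i, L (f i)) -> L (\sum_(i <- s) f i).
Proof.
by move=> Lf; elim/big_ind: _ => //; [exact: sublattice0|exact: sublatticeD].
Qed.

End Closure.

Lemma smallest_sublattice (X : Type) (G : set (X -> R)) :
  sublattice (smallest sublattice G).
Proof.
split.
- by move=> L [] /sublattice0.
- move=> a f g Lf Lg L LG; apply: (sublattice_lin LG.1); [exact: Lf|exact: Lg].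
- by move=> f g Lf Lg L LG; apply: (sublattice_max LG.1); [exact: Lf|exact: Lg].
- by move=> f g Lf Lg L LG; apply: (sublattice_min LG.1); [exact: Lf|exact: Lg].
Qed.

End Sublattices.

Definition FVL {R : realType} (E : normedModType R) : set (dual_space E -> R) :=
  smallest sublattice (range (@delta R E)).
Arguments FVL {R} E.

Section FVLTheory.
Context {R : realType} {E : normedModType R}.
Implicit Types (f g : dual_space E -> R) (x y : dual_space E).

Lemma FVL_sublattice : sublattice (FVL E).
Proof. exact: smallest_sublattice. Qed.

Lemma FVL_delta (v : E) : FVL E (delta v).
Proof. by apply: sub_gen_smallest; exists v. Qed.

(* Constants are absorbed in the vectors: [c * |x v - y v| = |x (c v) - y (c v)|]. *)
Definition lipschitz_along (s : seq E) f :=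
  forall x y, `|f x - f y| <= \sum_(v <- s) `|x v - y v|.

Let lip_hom f := pos_homogeneous f /\ exists s, lipschitz_along s f.

Lemma pos_homogeneous0 f : pos_homogeneous f -> f 0 = 0.
Proof. by move=> hf; rewrite -(scale0r 0) hf// mul0r. Qed.

Lemma lipschitz_along_le s f : pos_homogeneous f -> lipschitz_along s f ->
  forall x, `|f x| <= \sum_(v <- s) `|x v|.
Proof.
move=> hf fs x; have := fs x 0; rewrite (pos_homogeneous0 hf) subr0.
by under eq_bigr do rewrite dual0E subr0.
Qed.

Let lattice_op_lip (op : R -> R -> R) f g :
  (forall a b c d : R, `|op a b - op c d| <= `|a - c| + `|b - d|) ->
  (forall a b c : R, 0 <= c -> op (c * a) (c * b) = c * op a b) ->
  lip_hom f -> lip_hom g -> lip_hom (fun x => op (f x) (g x)).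
Proof.
move=> opl opZ [hf [s fs]] [hg [t gt]]; split.
  by move=> a x a0; rewrite hf// hg// opZ.
exists (s ++ t) => x y; rewrite big_cat/= (le_trans (opl _ _ _ _))//.
by rewrite lerD ?fs ?gt.
Qed.

Lemma max_lip (a b c d : R) : `|Num.max a b - Num.max c d| <= `|a - c| + `|b - d|.
Proof.
have h1 := ler_norm (a - c); have h2 := ler_norm (b - d).
have h3 := ler_norm (c - a); have h4 := ler_norm (d - b).
rewrite (distrC c) in h3; rewrite (distrC d) in h4.
have := normr_ge0 (a - c); have := normr_ge0 (b - d).
by rewrite ler_norml; case: (leP a b); case: (leP c d) => *; apply/andP; split; lra.
Qed.

Lemma min_lip (a b c d : R) : `|Num.min a b - Num.min c d| <= `|a - c| + `|b - d|.
Proof.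
have h1 := ler_norm (a - c); have h2 := ler_norm (b - d).
have h3 := ler_norm (c - a); have h4 := ler_norm (d - b).
rewrite (distrC c) in h3; rewrite (distrC d) in h4.
have := normr_ge0 (a - c); have := normr_ge0 (b - d).
by rewrite ler_norml; case: (leP a b); case: (leP c d) => *; apply/andP; split; lra.
Qed.

(** Positively homogeneous functions that are Lipschitz along some finite list form a sublattice
    containing every [delta v]. In particular an element of the free vector lattice depends on
    finitely many vectors only. *)
Lemma FVL_lip f : FVL E f -> pos_homogeneous f /\ exists s, lipschitz_along s f.
Proof.
have : FVL E `<=` lip_hom; last exact.
apply: smallest_sub; last first.
  move=> _ [v _ <-]; split; first by [].
  by exists [:: v] => x y; rewrite big_seq1.
split.
- split; first by move=> a x _; rewrite mulr0.
  by exists [::] => x y; rewrite big_nil subrr normr0.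
- move=> a f1 g [hf [s fs]] [hg [t gt]]; split.
    by move=> c x c0; rewrite !fctE hf// hg//= mulrDr [a *: _]mulrCA.
  exists ([seq a *: v | v <- s] ++ t) => x y; rewrite big_cat/= big_map.
  have -> : (a *: f1 + g) x - (a *: f1 + g) y = a * (f1 x - f1 y) + (g x - g y).
    by rewrite !fctE mulrBr opprD addrACA.
  rewrite (le_trans (ler_normD _ _))// lerD ?gt//.
  under eq_bigr do rewrite !(scalarZr (dual_scalar _)) -mulrBr normrM.
  by rewrite -mulr_sumr normrM ler_wpM2l.
- move=> f1 g; apply: (@lattice_op_lip Num.max); first exact: max_lip.
  by move=> a b c c0; rewrite maxr_pMr.
- move=> f1 g; apply: (@lattice_op_lip Num.min); first exact: min_lip.
  by move=> a b c c0; rewrite minr_pMr.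
Qed.

End FVLTheory.

(** * The norm of the free Banach lattice *)

(* The norm for [p = +oo] is the one for the exponent 1 restricted to tuples of
   length 1, which lets both cases be treated together. *)
Definition expo {R : realType} (p : \bar R) : R := if p is r%:E then r else 1.

Definition lens {R : realType} (p : \bar R) : set nat :=
  if p is _%:E then setT else [set 1%N].

(** The weak [p]-sum condition in homogeneous form, for all [v] instead of the unit ball; together
    with [nbd] it replaces extended-real suprema by real inequalities. *)
Definition adm {R : realType} {E : normedModType R} (p : \bar R) (n : nat)
    (x : 'I_n -> dual_space E) : Prop :=
  lens p n /\ forall v, \sum_(k < n) `|x k v| `^ expo p <= `|v| `^ expo p.

Definition nbd {R : realType} {E : normedModType R} (p : \bar R) (c : R)
    (f : dual_space E -> R) : Prop :=
  forall n (x : 'I_n -> dual_space E), adm p x -> lpn (expo p) (fun k => f (x k)) <= c.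

Section Norm.
Context {R : realType} (p : \bar R) (hp : (1 <= p)%E).

Lemma expo_ge1 : 1 <= expo p.
Proof. by case: p hp => //= r; rewrite lee_fin. Qed.

Local Notation r := (expo p).
Let r1 := expo_ge1.
Let r0 : 0 < r. Proof. exact: lt_le_trans r1. Qed.

Lemma lens1 : lens p 1%N.
Proof. by case: p. Qed.

Context {E : normedModType R}.
Implicit Types (f g : dual_space E -> R) (v : E).

Lemma weak_p_sum_leP n (x : 'I_n -> dual_space E) :
  (weak_p_sum r x <= 1)%E <-> forall v, \sum_(k < n) `|x k v| `^ r <= `|v| `^ r.
Proof.
split=> [h v|h].
  have [->|v0] := eqVneq v 0.
    rewrite normr0 big1 ?powR_ge0// => k _.
    by rewrite (scalar0 (dual_scalar _)) normr0 powR0// gt_eqF.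
  have nv : 0 < `|v| by rewrite normr_gt0.
  have : ((\sum_(k < n) `|x k (`|v|^-1 *: v)| `^ r)%:E <= 1)%E.
    apply: le_trans h; apply: ereal_sup_ubound; exists (`|v|^-1 *: v) => //.
    by rewrite /unit_ball/= normrZ normfV normr_id mulVf ?gt_eqF.
  rewrite lee_fin.
  under eq_bigr => k _.
    rewrite (scalarZr (dual_scalar _)) normrM normfV normr_id mulrC powR_div//.
    over.
  by rewrite -mulr_suml ler_pdivrMr ?powR_gt0// mul1r.
apply: ge_ereal_sup => _ [v v1 <-]; rewrite lee_fin (le_trans (h v))//.
have -> : 1 = 1 `^ r :> R by rewrite powR1.
by rewrite powR_le.
Qed.

Lemma dual_norm_leP (x : dual_space E) :
  (dual_norm x <= 1)%E <-> forall v, `|x v| <= `|v|.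
Proof.
split=> [h v|h].
  have [->|v0] := eqVneq v 0; first by rewrite (scalar0 (dual_scalar _)) !normr0.
  have nv : 0 < `|v| by rewrite normr_gt0.
  have : (`|x (`|v|^-1 *: v)|%:E <= 1)%E.
    apply: le_trans h; apply: ereal_sup_ubound; exists (`|v|^-1 *: v) => //.
    by rewrite /unit_ball/= normrZ normfV normr_id mulVf ?gt_eqF.
  rewrite lee_fin (scalarZr (dual_scalar _)) normrM normfV normr_id mulrC.
  by rewrite ler_pdivrMr// mul1r.
apply: ge_ereal_sup => _ [v v1 <-]; rewrite lee_fin (le_trans (h v))//.
Qed.

Lemma lpn1 (s : R) (a : 'I_1 -> R) : 1 <= s -> lpn s a = `|a ord0|.
Proof.
move=> s1; rewrite lpnE big_ord1 powR_K//.
Qed.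

Lemma adm1 (x : dual_space E) : (forall v, `|x v| <= `|v|) ->
  adm p (fun _ : 'I_1 => x).
Proof. by move=> h; split; [exact: lens1|move=> v; rewrite big_ord1 powR_le]. Qed.

End Norm.

Section NormChar.
Context {R : realType} (p : \bar R) (hp : (1 <= p)%E) {E : normedModType R}.
Implicit Types (f g : dual_space E -> R) (v : E).

Lemma fbl_norm_leP f c : (fbl_norm p f <= c%:E)%E <-> nbd p c f.
Proof.
case: p hp => [r r1|_|//]; split.
- move=> h n x [_ /(weak_p_sum_leP r1) x1]; rewrite -lee_fin.
  by apply: le_trans h; apply: ereal_sup_ubound; exists n, x; rewrite lpnE.
- move=> h; apply: ge_ereal_sup => _ [n [x [x1 ->]]]; rewrite lee_fin.
  by rewrite -lpnE; apply: h; split=> //; exact/(weak_p_sum_leP r1).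
- move=> h n x [/= n1]; move: x; rewrite n1 => x x1.
  rewrite lpn1// -lee_fin; apply: le_trans h; apply: ereal_sup_ubound.
  exists (x ord0) => //=; apply/dual_norm_leP => v.
  by have := x1 v; rewrite big_ord1 !powRr1.
- move=> h; apply: ge_ereal_sup => _ [x /dual_norm_leP x1 <-]; rewrite lee_fin.
  by have := h _ _ (adm1 (leey 1) x1); rewrite lpn1.
Qed.

Lemma fbl_norm_ltyP f : (fbl_norm p f < +oo)%E <-> exists c, nbd p c f.
Proof.
split=> [|[c /fbl_norm_leP h]]; last by rewrite (le_lt_trans h)// ltry.
case N : (fbl_norm p f) => [c||]// _; [exists c|exists 0]; apply/fbl_norm_leP.
  by rewrite N.
by rewrite N leNye.
Qed.

Lemma fbl_closureP (A : set (dual_space E -> R)) f : fbl_closure p A f <->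
  [/\ pos_homogeneous f, exists c, nbd p c f &
    forall e : R, 0 < e -> exists2 g, A g & nbd p e (f - g)].
Proof.
split=> -[hf fb fA]; split=> //; [exact/fbl_norm_ltyP| |exact/fbl_norm_ltyP|] => e e0.
  by have [g Ag /ltW/fbl_norm_leP gf] := fA e e0; exists g.
have [|g Ag /fbl_norm_leP gf] := fA (e / 2); first by rewrite divr_gt0.
by exists g => //; rewrite (le_lt_trans gf)// lte_fin gtr_pMr// invf_lt1// ltr1n.
Qed.

End NormChar.

Section NormTheory.
Context {R : realType} (p : \bar R) (hp : (1 <= p)%E) {E : normedModType R}.
Implicit Types (f g : dual_space E -> R) (v : E).
Let r1 := expo_ge1 hp.

Lemma nbd_ext c f g : (forall x, `|f x| = `|g x|) -> nbd p c f -> nbd p c g.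
Proof.
by move=> fg h n x ax; rewrite -(lpn_ext _ (fun k => fg (x k))); exact: h.
Qed.

Lemma nbd_mono c f g : (forall x, `|f x| <= `|g x|) -> nbd p c g -> nbd p c f.
Proof.
move=> fg h n x ax; apply: le_trans (h n x ax); apply: (ler_lpn r1) => k; exact: fg.
Qed.

Lemma nbd_le c d f : c <= d -> nbd p c f -> nbd p d f.
Proof. by move=> cd h n x ax; apply: le_trans (h n x ax) cd. Qed.

Lemma nbdD c d f g : nbd p c f -> nbd p d g -> nbd p (c + d) (f + g).
Proof.
move=> h k n x ax; apply: (le_trans (lpnD _ _ _)) => //.
by rewrite lerD ?h ?k.
Qed.

Lemma nbdZ (a : R) c f : nbd p c f -> nbd p (`|a| * c) (a *: f).
Proof. by move=> h n x ax; rewrite (lpnZ r1) ler_wpM2l ?h. Qed.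

Lemma nbdN c f : nbd p c f -> nbd p c (- f).
Proof. by apply: nbd_ext => x; rewrite /= normrN. Qed.

Lemma nbdB c d f g : nbd p c f -> nbd p d g -> nbd p (c + d) (f - g).
Proof. by move=> h k; apply: nbdD h _; exact: nbdN. Qed.

Lemma nbd0 : nbd p 0 (0 : dual_space E -> R).
Proof.
have rn0 : expo p != 0 by rewrite gt_eqF// (lt_le_trans _ r1).
by move=> n x _; rewrite lpn_leP// powR0// big1// => k _; rewrite normr0 powR0.
Qed.

Lemma nbd_sum (I : Type) (s : seq I) (c : I -> R) (f : I -> dual_space E -> R) :
  (forall i, nbd p (c i) (f i)) -> nbd p (\sum_(i <- s) c i) (\sum_(i <- s) f i).
Proof.
move=> h; elim/big_rec2: _ => [|i g d _ k]; first exact: nbd0.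
exact: nbdD.
Qed.

Lemma nbd_delta v : nbd p `|v| (delta v).
Proof. by move=> n x [_ x1]; rewrite lpn_leP//; exact: x1. Qed.

Lemma nbd_ge0 c f : nbd p c f -> 0 <= c.
Proof.
have a0 : adm p (fun _ : 'I_1 => 0 : dual_space E).
  by apply: adm1 => // v; rewrite normr0.
by move=> /(_ _ _ a0); apply: le_trans; exact: lpn_ge0.
Qed.

(** Test the norm on the one-element tuple [K^-1 *: x]. Norm convergence is thus uniform on bounded
    sets of functionals. *)
Lemma nbd_point c f (x : dual_space E) (K : R) : pos_homogeneous f -> nbd p c f ->
  0 < K -> (forall v, `|x v| <= K * `|v|) -> `|f x| <= c * K.
Proof.
move=> hf fc K0 xK.
have ax : adm p (fun _ : 'I_1 => K^-1 *: x).
  apply: adm1 => // v.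
  by rewrite dualZE normrM gtr0_norm ?invr_gt0// mulrC ler_pdivrMr// mulrC.
have := fc _ _ ax; rewrite lpn1// hf ?invr_ge0 ?(ltW K0)// normrM.
by rewrite gtr0_norm ?invr_gt0// mulrC ler_pdivrMr.
Qed.

Lemma nbd_lipschitz_along (s : seq E) f : pos_homogeneous f -> lipschitz_along s f ->
  nbd p (\sum_(v <- s) `|v|) f.
Proof.
move=> hf /(lipschitz_along_le hf) fs.
have := @nbd_sum _ s (fun v => `|v|) (fun v x => `|delta v x|).
move=> /(_ (fun v => nbd_ext (fun x => esym (normr_id _)) (@nbd_delta v))).
move=> h; apply: (nbd_mono _ h) => x.
rewrite (le_trans (fs x))// (le_trans _ (ler_norm _))//.
by rewrite fct_sumE.
Qed.

Lemma FVL_sub_FBL : FVL E `<=` FBL p E.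
Proof.
move=> f Lf; have [hf [s fs]] := FVL_lip Lf.
apply/(fbl_closureP hp); split=> //.
  by exists (\sum_(v <- s) `|v|); exact: nbd_lipschitz_along.
move=> e e0; exists f => //; rewrite subrr.
by apply: (nbd_le (ltW e0)); exact: nbd0.
Qed.

Lemma FBL_hom f : FBL p E f -> pos_homogeneous f.
Proof. by case. Qed.

Lemma FBL_nbd f : FBL p E f -> exists c, nbd p c f.
Proof. by move=> /(fbl_closureP hp)[]. Qed.

Lemma FBL_approx f (e : R) : FBL p E f -> 0 < e -> exists2 g, FVL E g & nbd p e (f - g).
Proof. by move=> /(fbl_closureP hp)[_ _]; exact. Qed.

Lemma fbl_closure_sublattice (A : set (dual_space E -> R)) :
  sublattice A -> sublattice (fbl_closure p A).
Proof.
move=> hA.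
(* The three operations are treated at once: a Lipschitz operation is continuous for the norm, and
   [op 0 0 = 0] turns the Lipschitz estimate into finiteness of the norm. *)
have lift (op : (dual_space E -> R) -> (dual_space E -> R) -> dual_space E -> R)
    (C : R) f g :
    (forall f g, A f -> A g -> A (op f g)) ->
    (forall f g, pos_homogeneous f -> pos_homogeneous g -> pos_homogeneous (op f g)) ->
    op 0 0 = 0 -> 0 < C ->
    (forall f g f' g' x, `|op f g x - op f' g' x| <= C * (`|f x - f' x| + `|g x - g' x|)) ->
    fbl_closure p A f -> fbl_closure p A g -> fbl_closure p A (op f g).
  move=> opA oph op0 C0 opl /(fbl_closureP hp)[hf [c fc] fA] /(fbl_closureP hp)[hg [d gd] gA].
  have key c' d' (f' g' : dual_space E -> R) : nbd p c' (f - f') -> nbd p d' (g - g') ->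
      nbd p (C * (c' + d')) (op f g - op f' g').
    move=> h k.
    have := nbdZ C (nbdD (nbd_ext (g := fun x => `|(f - f') x|) _ h)
                         (nbd_ext (g := fun x => `|(g - g') x|) _ k)).
    rewrite gtr0_norm// => /(_ (fun x => esym (normr_id _)) (fun x => esym (normr_id _))).
    apply: nbd_mono => x; rewrite (le_trans (opl _ _ _ _ _))//.
    by rewrite (le_trans _ (ler_norm _)).
  apply/(fbl_closureP hp); split; first exact: oph.
    exists (C * (c + d)); have := key c d 0 0; rewrite op0 !subr0.
    exact.
  move=> e e0.
  have e'0 : 0 < e / C / 2 by rewrite !divr_gt0.
  have [f' Af ff'] := fA _ e'0; have [g' Ag gg'] := gA _ e'0.
  exists (op f' g'); first exact: opA.
  have := key _ _ _ _ ff' gg'.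
  by rewrite -splitr mulrC divfK// gt_eqF.
split.
- apply/(fbl_closureP hp); split; first by move=> a x _; rewrite mulr0.
    by exists 0; exact: nbd0.
  move=> e e0; exists 0; first exact: sublattice0.
  by rewrite subr0; apply: (nbd_le (ltW e0)); exact: nbd0.
- move=> a f g; apply: (lift (fun f g => a *: f + g) (`|a| + 1)).
  + by move=> *; exact: sublattice_lin.
  + by move=> f' g' hf hg c x c0; rewrite !fctE hf// hg// mulrDr [a *: _]mulrCA.
  + by rewrite scaler0 addr0.
  + by rewrite ltr_wpDl.
  + move=> f1 g1 f2 g2 x; rewrite !fctE.
    have -> : a *: f1 x + g1 x - (a *: f2 x + g2 x) = a * (f1 x - f2 x) + (g1 x - g2 x).
      by rewrite mulrBr opprD addrACA.
    rewrite (le_trans (ler_normD _ _))// normrM mulrDr.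
    by rewrite lerD// ?ler_wpM2r ?lerDl// ler_peMl ?lerDr.
- move=> f g; apply: (lift (fun f g => f \max g) 1) => //.
  + by move=> *; exact: sublattice_max.
  + by move=> f' g' hf hg c x c0; rewrite /= hf// hg// maxr_pMr.
  + by apply/funext => x /=; rewrite maxxx.
  + by move=> f1 g1 f2 g2 x; rewrite mul1r; exact: max_lip.
- move=> f g; apply: (lift (fun f g => f \min g) 1) => //.
  + by move=> *; exact: sublattice_min.
  + by move=> f' g' hf hg c x c0; rewrite /= hf// hg// minr_pMr.
  + by apply/funext => x /=; rewrite minxx.
  + by move=> f1 g1 f2 g2 x; rewrite mul1r; exact: min_lip.
Qed.

Lemma FBL_sublattice : sublattice (FBL p E).
Proof. exact: fbl_closure_sublattice FVL_sublattice. Qed.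

End NormTheory.

(** * Lattice homomorphisms of free Banach lattices are composition operators *)

Section Series.
Context {R : realType} (p : \bar R) (hp : (1 <= p)%E) {E : normedModType R}.

(** Completeness in the form needed: the sum is defined pointwise, and the bounds on the tails
    survive the limit tuple by tuple. *)
Lemma FBL_series (u : nat -> dual_space E -> R) (d : R) :
  (forall n, FVL E (u n)) -> (forall n, nbd p (d * 2^-1 ^+ n) (u n)) ->
  exists2 f, FBL p E f & forall x, (\sum_(i < n) u i x) @[n --> \oo] --> f x.
Proof.
move=> uL ud.
have d0 : 0 <= d by have := nbd_ge0 hp (ud 0%N); rewrite mulr1.
have uhom n : pos_homogeneous (u n) := (FVL_lip (uL n)).1.
have sumle (n : nat) (c : R) : 0 <= c -> \sum_(i < n) (c * 2^-1 ^+ i) <= 2 * c.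
  by move=> c0; rewrite -mulr_sumr mulrC ler_wpM2r// sum_half_pow.
have pcvg x : exists l : R, (\sum_(i < n) u i x) @[n --> \oo] --> l.
  have [K K0 xK] := dual_bounded x.
  have [|l _ ul] := @norm_bounded_series_cvg R R (fun n => u n x) (2 * (d * K)).
    move=> n; apply: le_trans (sumle n _ (mulr_ge0 d0 (ltW K0))); apply: ler_sum => i _.
    by rewrite mulrAC; apply: (nbd_point hp) xK.
  by exists l.
have [f fP] := choice pcvg; exists f => //.
have hf : pos_homogeneous f.
  move=> a x a0; apply: (cvg_unique _ (fP (a *: x))) => //.
  have -> : (fun n => \sum_(i < n) u i (a *: x)) = (fun n => a * \sum_(i < n) u i x).
    by apply/funext => n; rewrite mulr_sumr; apply: eq_bigr => i _; rewrite uhom.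
  by apply: cvgMr; exact: fP.
have tail N : nbd p (2 * (d * 2^-1 ^+ N)) (f - \sum_(i < N) u i).
  (* A tuple is finite, so one partial sum is [e]-close to [f] at all its members. *)
  move=> n x ax; apply: (lpn_closed (expo_ge1 hp)) => e e0.
  have near_k : \forall m \near \oo, forall k, `|f (x k) - \sum_(i < m) u i (x k)| <= e.
    by apply: filter_forall => k; have /cvgrPdist_le := fP (x k); exact.
  near \oo => m.
  have Nm : (N <= m)%N by near: m; exact: nbhs_infty_ge.
  exists (fun k => (\sum_(i < m - N) u (N + i)%N) (x k)).
    have h := @nbd_sum _ _ hp E _ (index_enum 'I_(m - N))
      (fun i => d * 2^-1 ^+ N * 2^-1 ^+ i) (fun i => u (N + i)%N).
    apply: (nbd_le (sumle (m - N)%N _ _) (h _)) => //.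
      by rewrite mulr_ge0// exprn_ge0// invr_ge0.
    by move=> i; rewrite -mulrA -exprD.
  move=> k; rewrite !fctE !fct_sumE -addrA -opprD.
  have -> : \sum_(i < N) u i (x k) + \sum_(i < m - N) u (N + i)%N (x k) =
      \sum_(i < m) u i (x k).
    have -> : \sum_(i < m) u i (x k) = \sum_(i < N + (m - N)) u i (x k) by rewrite subnKC.
    by rewrite big_split_ord.
  by move: k; near: m.
apply/(fbl_closureP hp); split => //.
  by exists (2 * (d * 2^-1 ^+ 0)); have := tail 0%N; rewrite big_ord0 subr0.
move=> e e0; have : \forall n \near \oo, (2 * d) * 2^-1 ^+ n <= e by exact: half_pow_small.
move=> /filter_ex[n nle]; exists (\sum_(i < n) u i).
  by apply: (sublattice_sum FVL_sublattice).
by apply: (nbd_le _ (tail n)); rewrite mulrA.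
Unshelve. all: by end_near. Qed.

End Series.

Section LatticeHom.
Context {R : realType}.

Lemma lattice_hom_mono (X Y : Type) (A : set (X -> R)) (B : set (Y -> R)) Phi f g :
  lattice_hom A B Phi -> A f -> A g -> (forall x, f x <= g x) ->
  forall y, Phi f y <= Phi g y.
Proof.
move=> hPhi Af Ag fg y.
have <- : f \max g = g by apply/funext => x; apply/max_idPr.
by rewrite (lattice_hom_max hPhi)//= le_max lexx.
Qed.

Context (p : \bar R) (hp : (1 <= p)%E) {F E : normedModType R} (T : {linear F -> E}).
Context (hT : continuous T).
Context (Tbar : (dual_space F -> R) -> (dual_space E -> R)).
Context (hTbar : lattice_hom (FBL p F) (FBL p E) Tbar).
Context (hTbar_delta : forall x : F, Tbar (delta x) = delta (T x)).

Let FVL_FBL := @FVL_sub_FBL R p hp F.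

Lemma lattice_hom_adjoint_FVL f : FVL F f -> forall y, Tbar f y = f (adjoint hT y).
Proof.
(* Membership in [FVL F] is carried along because the laws of [Tbar] are available only on
   [FBL p F]. *)
have h : FVL F `<=` [set g | FVL F g /\ forall y, Tbar g y = g (adjoint hT y)].
  apply: smallest_sub; last first.
    by move=> _ [v _ <-]; split; [exact: FVL_delta|rewrite hTbar_delta].
  split.
  - split=> [|y]; first exact: (sublattice0 FVL_sublattice).
    have F0 : FBL p F 0 := sublattice0 (FBL_sublattice hp).
    have := lattice_hom_linear hTbar (-1) F0 F0.
    by rewrite scaler0 addr0 scaleN1r addNr => ->.
  - move=> a g k [Fg gP] [Fk kP]; split; first exact: (sublattice_lin FVL_sublattice).
    move=> y; rewrite (lattice_hom_linear hTbar)//; try exact: FVL_FBL.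
    by rewrite !fctE gP kP.
  - move=> g k [Fg gP] [Fk kP]; split; first exact: (sublattice_max FVL_sublattice).
    move=> y; rewrite (lattice_hom_max hTbar)//=; try exact: FVL_FBL.
    by rewrite gP kP.
  - move=> g k [Fg gP] [Fk kP]; split; first exact: (sublattice_min FVL_sublattice).
    move=> y; rewrite (lattice_hom_min hTbar)//=; try exact: FVL_FBL.
    by rewrite gP kP.
by move=> /h[].
Qed.

(* [Tbar] is not assumed continuous.  Any [f] in the completion is a relatively
   uniform limit [|f - g n| <= 2^-n u] of elements of the free vector lattice, and
   relatively uniform limits are preserved by lattice homomorphisms. *)
Lemma FBL_relatively_uniform f : FBL p F f -> exists (g : nat -> dual_space F -> R) u,
  [/\ forall n, FVL F (g n), FBL p F u &
      forall n x, `|f x - g n x| <= 2^-1 ^+ n * u x].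
Proof.
move=> Ff; have hf := FBL_hom Ff.
(* The rate [4^-n] leaves norms of order [2^-n] after the weights [2 ^+ n] in [v], so that [u], the
   sum of the [v n], exists. *)
have e0 n : 0 < (4^-1 : R) ^+ n by rewrite exprn_gt0// invr_gt0.
have /choice[g gP] : forall n, exists g, FVL F g /\ nbd p (4^-1 ^+ n) (f - g).
  by move=> n; have [g] := FBL_approx hp Ff (e0 n); exists g.
have gL n := (gP n).1; have gf n := (gP n).2.
have ghom n : pos_homogeneous (g n) := (FVL_lip (gL n)).1.
pose v n x := 2 ^+ n * `|g n.+1 x - g n x|.
have vL n : FVL F (v n).
  apply: (sublatticeZ FVL_sublattice (2 ^+ n) (f := fun x => `|(g n.+1 - g n) x|)).
  apply: (sublattice_norm FVL_sublattice).
  exact: (sublatticeB FVL_sublattice).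
have vn n : nbd p (2 * 2^-1 ^+ n) (v n).
  have h := nbdZ hp (2 ^+ n) (nbdB hp (gf n) (gf n.+1)).
  have h' := @nbd_ext _ _ _ _ _ (v n) _ h.
  apply: nbd_le (h' _); last first.
    move=> x; rewrite !fctE /v !normrM normr_id; congr (_ * `|_|).
    by ring.
  rewrite gtr0_norm ?exprn_gt0// exprS.
  have E1 : 2 ^+ n * 4^-1 ^+ n = 2^-1 ^+ n :> R.
    by rewrite -exprMn; congr (_ ^+ _); lra.
  rewrite mulrDr [4^-1 * _]mulrC mulrA E1.
  have : 0 < 2^-1 ^+ n :> R by rewrite exprn_gt0 ?invr_gt0.
  by lra.
have [u uF uP] := FBL_series hp vL vn.
exists g, u; split=> // n x.
have v0 i : 0 <= v i x by rewrite mulr_ge0// exprn_ge0.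
have su m : \sum_(i < m) v i x <= u x.
  have h : nondecreasing_seq (fun m => \sum_(i < m) v i x).
    apply/nondecreasing_seqP => k; rewrite big_ord_recr/= lerDl; exact: v0.
  have cv : cvgn (fun m => \sum_(i < m) v i x) by apply/cvg_ex; exists (u x); exact: uP.
  have := nondecreasing_cvgn_le h cv m.
  by rewrite (cvg_lim _ (uP x)).
(* Telescoping: each increment of [g] from index [n] on carries a weight at least [2 ^+ n] in
   [v]. *)
have gle j : `|g (n + j)%N x - g n x| <= 2^-1 ^+ n * \sum_(i < n + j) v i x.
  elim: j => [|j IH].
    rewrite addn0 subrr normr0 mulr_ge0 ?exprn_ge0 ?invr_ge0//.
    by apply: sumr_ge0.
  rewrite addnS big_ord_recr/= mulrDr.
  have -> : g (n + j).+1 x - g n x = (g (n + j)%N x - g n x) + (g (n + j).+1 x - g (n + j)%N x).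
    by ring.
  rewrite (le_trans (ler_normD _ _))// lerD// /v mulrA ler_peMl//.
  by rewrite exprD mulrA -exprMn mulVf// expr1n mul1r exprn_ege1// ler1n.
apply/ler_addgt0Pl => e epos.
have [K K0 xK] := dual_bounded x.
have : \forall m \near \oo, K * 2^-1 ^+ m <= e by exact: half_pow_small.
move=> /filter_ex[m mle].
have fm : `|f x - g (n + m)%N x| <= e.
  apply: le_trans mle.
  have hom : pos_homogeneous (f - g (n + m)%N).
    by move=> a z a0; rewrite !fctE hf// ghom// mulrBr.
  apply: (le_trans (nbd_point hp hom (gf _) K0 xK)).
  rewrite mulrC ler_wpM2l ?(ltW K0)// exprD.
  apply: (@le_trans _ _ (4^-1 ^+ m)).
    by rewrite ler_piMl ?exprn_ge0 ?invr_ge0// exprn_ile1// ?invr_ge0// invf_le1// ler1n.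
  by rewrite lerXn2r ?nnegrE ?invr_ge0//; lra.
rewrite -(subrK (g (n + m)%N x) (f x)) -addrA (le_trans (ler_normD _ _))// lerD//.
rewrite (le_trans (gle m))// ler_wpM2l ?exprn_ge0 ?invr_ge0//.
Qed.

(** Monotonicity of [Tbar] applied to [f <= 2^-n u + g n] and [g n <= 2^-n u + f] confines
    [Tbar f y] to an interval around [g n] at the adjoint functional, of radius tending to 0. *)
Lemma lattice_hom_adjoint f : FBL p F f -> forall y, Tbar f y = f (adjoint hT y).
Proof.
move=> Ff y; have [g [u [gL uF gu]]] := FBL_relatively_uniform Ff.
have gF n : FBL p F (g n) := FVL_FBL (gL n).
have bound n : `|Tbar f y - f (adjoint hT y)| <=
    (Tbar u y + u (adjoint hT y)) * 2^-1 ^+ n.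
  have h1 : Tbar f y <= 2^-1 ^+ n * Tbar u y + Tbar (g n) y.
    have := lattice_hom_mono hTbar (g := 2^-1 ^+ n *: u + g n) Ff.
    rewrite (lattice_hom_linear hTbar)// => /(_ (sublattice_lin (FBL_sublattice hp) _ uF (gF n)) _ y).
    apply=> x; rewrite !fctE.
    by have := gu n x; rewrite ler_norml => /andP[_]; rewrite lerBlDr.
  have h2 : Tbar (g n) y <= 2^-1 ^+ n * Tbar u y + Tbar f y.
    have := lattice_hom_mono hTbar (g := 2^-1 ^+ n *: u + f) (gF n).
    rewrite (lattice_hom_linear hTbar)// => /(_ (sublattice_lin (FBL_sublattice hp) _ uF Ff) _ y).
    apply=> x; rewrite !fctE.
    by have := gu n x; rewrite distrC ler_norml => /andP[_]; rewrite lerBlDr.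
  have := gu n (adjoint hT y); rewrite -(lattice_hom_adjoint_FVL (gL n)).
  rewrite !ler_norml => /andP[h3 h4]; apply/andP; split; lra.
apply/eqP; rewrite -subr_eq0 -normr_le0; apply/ler_addgt0Pl => e e0; rewrite addr0.
have := half_pow_small (Tbar u y + u (adjoint hT y)) e0.
by move=> /filter_ex[n]; exact: le_trans (bound n).
Qed.

End LatticeHom.

(** * Weak-star approximation and injectivity *)

Section WeakApproximation.
Context {R : realType} {F : normedModType R}.
Implicit Types (K V : set (dual_space F)) (x y : dual_space F) (z : F).

(* Minimise the squared distance [J] to [x] over the convex set [K]: at a near
   minimiser [v], the vector [w] representing the gradient of [J] separates [x]
   from [K] unless [J v] is small. *)
Lemma finite_weak_approx K x (s : seq F) (e : R) : K !=set0 ->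
  (forall t u v, 0 <= t <= 1 -> K u -> K v -> K (u + t *: (v - u))) ->
  (forall z, exists M, forall v, K v -> `|v z| <= M) ->
  (forall z (h : R), 0 < h -> exists2 v, K v & x z <= v z + h) ->
  0 < e -> exists2 v, K v & forall z, z \in s -> `|x z - v z| <= e.
Proof.
move=> [v0 Kv0] Kconv Kbnd xK e0.
pose J v := \sum_(z <- s) (x z - v z) ^+ 2.
suff [v Kv Jv] : exists2 v, K v & J v <= e ^+ 2.
  exists v => // z zs; rewrite -[leRHS](ger0_norm (ltW e0)) -ler_sqr ?nnegrE//.
  rewrite !real_normK ?num_real//; apply: le_trans Jv.
  rewrite /J (big_rem z)//= lerDl; apply: sumr_ge0 => i _; exact: sqr_ge0.
apply: contrapT => noK.
have eJ v : K v -> e ^+ 2 <= J v.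
  by move=> Kv; rewrite leNgt; apply/negP => Jv; apply: noK; exists v => //; exact: ltW.
pose D := inf [set J v | v in K].
have D0 : 0 < D.
  apply: (@lt_le_trans _ _ (e ^+ 2)); first by rewrite exprn_gt0.
  by apply: lb_le_inf; [exists (J v0), v0|move=> _ [v Kv <-]; exact: eJ].
have DJ v : K v -> D <= J v.
  move=> Kv; apply: ge_inf; last by exists v.
  by exists (e ^+ 2) => _ [u Ku <-]; exact: eJ.
have /choice[M MP] := Kbnd.
pose Q := \sum_(z <- s) (M z + M z) ^+ 2.
have Q0 : 0 <= Q by apply: sumr_ge0 => z _; exact: sqr_ge0.
have Qle u v : K u -> K v -> \sum_(z <- s) (v z - u z) ^+ 2 <= Q.
  move=> Ku Kv; apply: ler_sum => z _.
  have M0 : 0 <= M z := le_trans (normr_ge0 _) (MP z u Ku).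
  rewrite -(real_normK (num_real (v z - u z))) ler_sqr ?nnegrE ?addr_ge0//.
  by rewrite (le_trans (ler_normB _ _))// lerD// MP.
(* This step length keeps the quadratic term of [J u] below [t * D / 2], while the linear term
   lowers it by at least [3 * t * D / 2]. As [J v < D + t * D / 2], this gives [J u < D], a
   contradiction. *)
pose t := D / (D + 2 * Q).
have den0 : 0 < D + 2 * Q by rewrite ltr_pwDl// mulr_ge0.
have t0 : 0 < t by rewrite divr_gt0.
have t1 : t <= 1 by rewrite ler_pdivrMr// mul1r lerDl mulr_ge0.
have tQ : t * Q <= D / 2.
  rewrite mulrAC ler_pdivrMr//.
  have : 0 <= D * D by rewrite mulr_ge0// ltW.
  by lra.
have tD : 0 < t * D / 2 by rewrite divr_gt0// mulr_gt0.
have [_ [v Kv <-] Jv] : exists2 j, [set J v | v in K] j & j < D + t * D / 2.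
  apply: inf_adherent => //; split; first by exists (J v0), v0.
  by exists (e ^+ 2) => _ [u Ku <-]; exact: eJ.
pose w := \sum_(z <- s) (x z - v z) *: z.
have wE (y : dual_space F) : y w = \sum_(z <- s) (x z - v z) * y z.
  rewrite /w; elim/big_rec2: _ => [|z a b _ <-]; first exact: (scalar0 (dual_scalar _)).
  exact: (dual_scalar y).
have D4 : 0 < D / 4 by rewrite divr_gt0.
have [v' Kv' xv'] := xK w _ D4.
have [u uE] : exists u, u = v + t *: (v' - v) by exists (v + t *: (v' - v)).
have Ku : K u by rewrite uE; apply: Kconv => //; rewrite (ltW t0).
have Ju : J u = J v - 2 * t * (v' w - v w) + t ^+ 2 * \sum_(z <- s) (v' z - v z) ^+ 2.
  rewrite /J !wE -sumrB !mulr_sumr -sumrB -big_split/=; apply: eq_bigr => z _.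
  by rewrite uE dualDE dualZE dualBE; ring.
have xw : x w - v w = J v.
  by rewrite /J !wE -sumrB; apply: eq_bigr => z _; ring.
have h1 := DJ _ Ku; have h2 := DJ _ Kv.
have h3 : t ^+ 2 * \sum_(z <- s) (v' z - v z) ^+ 2 <= t * (D / 2).
  rewrite expr2 -mulrA ler_wpM2l ?(ltW t0)//; apply: le_trans tQ.
  by rewrite ler_wpM2l ?(ltW t0)// Qle.
have h4 : t * (D * (3 / 4)) <= t * (v' w - v w).
  by rewrite ler_wpM2l ?(ltW t0)//; lra.
by move: h1; rewrite Ju; lra.
Qed.

Definition subspace V := V 0 /\ forall (a : R) x y, V x -> V y -> V (a *: x + y).

Lemma subspaceZ V (a : R) x : subspace V -> V x -> V (a *: x).
Proof. by case=> V0 VP Vx; rewrite -[_ *: _]addr0; exact: VP. Qed.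

Definition dual_ball V : set (dual_space F) := [set v | V v /\ forall z, `|v z| <= `|z|].

(** The gauge of the polar in [F] of the unit ball of [V]. *)
Definition polar_seminorm V z : R := sup [set `|v z| | v in dual_ball V].

Section PolarSeminorm.
Context (V : set (dual_space F)) (hV : subspace V).
Local Notation q := (polar_seminorm V).

Lemma dual_ball0 : dual_ball V 0.
Proof. by split=> [|z]; [case: hV|rewrite dual0E normr0]. Qed.

Lemma polar_seminorm_ub v z : dual_ball V v -> `|v z| <= q z.
Proof.
move=> Bv; apply: ub_le_sup; last by exists v.
by exists `|z| => _ [u [_ uz] <-]; exact: uz.
Qed.

Lemma polar_seminorm_le z c : (forall v, dual_ball V v -> `|v z| <= c) -> q z <= c.
Proof.
move=> h; apply: ge_sup; first by exists `|(0 : dual_space F) z|, 0 => //; exact: dual_ball0.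
by move=> _ [v Bv <-]; exact: h.
Qed.

Lemma polar_seminorm_le_norm z : q z <= `|z|.
Proof. by apply: polar_seminorm_le => v []. Qed.

Lemma polar_seminormP : seminorm q.
Proof.
have homo_le (t : R) z : q (t *: z) <= `|t| * q z.
  apply: polar_seminorm_le => v Bv.
  by rewrite (scalarZr (dual_scalar _)) normrM ler_wpM2l// polar_seminorm_ub.
split=> [x y|t z].
  apply: polar_seminorm_le => v Bv; rewrite (scalarD (dual_scalar _)).
  by rewrite (le_trans (ler_normD _ _))// lerD// polar_seminorm_ub.
apply/le_anti; rewrite homo_le/=.
have [->|t0] := eqVneq t 0.
  by rewrite normr0 mul0r (le_trans _ (polar_seminorm_ub _ dual_ball0)).
have := homo_le t^-1 (t *: z); rewrite scalerA mulVf// scale1r normfV.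
by rewrite mulrC ler_pdivlMr ?normr_gt0// mulrC.
Qed.

Lemma polar_seminorm_scaled v (C : R) : V v -> 0 < C ->
  (forall z, `|v z| <= C * `|z|) -> forall z, `|v z| <= C * q z.
Proof.
move=> Vv C0 vC z.
have : dual_ball V (C^-1 *: v).
  split; first exact: subspaceZ.
  by move=> u; rewrite dualZE normrM gtr0_norm ?invr_gt0// mulrC ler_pdivrMr// mulrC.
move=> /(polar_seminorm_ub z).
by rewrite dualZE normrM gtr0_norm ?invr_gt0// mulrC ler_pdivrMr// mulrC.
Qed.

(** Bipolar theorem: [C * q] is the support function of the [C]-ball of [V], which is convex and
    symmetric, so [x] lies in its weak-star closure. *)
Lemma bipolar_approx x (C : R) (s : seq F) (e : R) : 0 < C ->
  (forall z, `|x z| <= C * q z) -> 0 < e ->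
  exists v, [/\ V v, forall z, `|v z| <= C * `|z| &
    forall z, z \in s -> `|x z - v z| <= e].
Proof.
move=> C0 xC e0.
pose K := [set v | V v /\ forall z, `|v z| <= C * `|z|].
have K0 : K 0.
  by split=> [|z]; [case: hV|rewrite dual0E normr0 mulr_ge0// ltW].
have [||||v [Vv vC] xv] := @finite_weak_approx K x s e _ _ _ _ e0; last by exists v.
- by exists 0.
- move=> t u v /andP[t0 t1] [Vu uC] [Vv vC]; split.
    have -> : u + t *: (v - u) = t *: v + (1 - t) *: u.
      by apply: dual_ext => z; rewrite !dualDE !dualZE dualBE; ring.
    by case: (hV) => _; apply => //; exact: subspaceZ.
  move=> z.
  have -> : (u + t *: (v - u)) z = (1 - t) * u z + t * v z.
    by rewrite !dualDE !dualZE dualBE; ring.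
  rewrite (le_trans (ler_normD _ _))// !normrM (ger0_norm t0) ger0_norm ?subr_ge0//.
  apply: (@le_trans _ _ ((1 - t) * (C * `|z|) + t * (C * `|z|))).
    by rewrite lerD// ler_wpM2l// subr_ge0.
  by lra.
- by move=> z; exists (C * `|z|) => v [].
move=> z h h0.
have h1 : 0 < h / C by rewrite divr_gt0.
have [_ [v [Vv vB] <-] vz] : exists2 j, [set `|v z| | v in dual_ball V] j & q z - h / C < j.
  apply: sup_adherent => //; split.
    by exists `|(0 : dual_space F) z|, 0 => //; exact: dual_ball0.
  by exists `|z| => _ [u [_ uz] <-]; exact: uz.
have xz := le_trans (ler_norm _) (xC z).
have hC : C * (q z - h / C) = C * q z - h by rewrite mulrBr mulrCA divff ?mulr1// gt_eqF.
have h2 : C * q z - h <= C * `|v z| by rewrite -hC ler_wpM2l ?ltW.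
have mem (a : R) : `|a| = C -> K (a *: v).
  move=> aC; split; first exact: subspaceZ.
  by move=> u; rewrite dualZE normrM aC ler_wpM2l// ltW.
have [v0|v0] := leP 0 (v z).
  exists (C *: v); first by apply: mem; rewrite gtr0_norm.
  by move: h2; rewrite dualZE ger0_norm//; lra.
exists ((- C) *: v); first by apply: mem; rewrite normrN gtr0_norm.
by move: h2; rewrite dualZE ltr0_norm//; lra.
Qed.

End PolarSeminorm.

Lemma maximal_vanishing_subspace V (f : dual_space F -> R) : subspace V ->
  (forall x, V x -> f x = 0) ->
  exists U, [/\ subspace U, V `<=` U, forall x, U x -> f x = 0 &
    forall U', subspace U' -> (forall x, U' x -> f x = 0) -> U `<=` U' -> U' `<=` U].
Proof.
move=> hV fV.
(* Requiring [V] joined with [A] to be a subspace, rather than [A] itself, makes [P] hold for the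
   union of the empty chain. *)
pose P A := subspace (V `|` A) /\ forall x, (V `|` A) x -> f x = 0.
have [A Atot Ac|A [[hA fA] Amax]] := @Zorn_bigcup _ P.
  have [A0|/set0P[A0 AA0]] := eqVneq A set0.
    by rewrite A0 bigcup_set0 /P setU0.
  split; last first.
    move=> x [/fV//|[B AB Bx]]; apply: (Atot _ AB).2; by right.
  split; first by left; case: hV.
  have up (B : set (dual_space F)) : A B -> V `|` B `<=` V `|` \bigcup_(X in A) X.
    by move=> AB x [Vx|Bx]; [left|right; exists B].
  have cl (B : set (dual_space F)) (a : R) x y : A B -> (V `|` B) x -> (V `|` B) y ->
      (V `|` \bigcup_(X in A) X) (a *: x + y).
    by move=> AB Bx By; apply: (up B AB); exact: (Atot _ AB).1.2.
  move=> a x y [Vx|[B AB Bx]] [Vy|[B' AB' By]].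
  - by left; exact: hV.2.
  - by apply: (cl B' a x y AB'); [left|right].
  - by apply: (cl B a x y AB); [right|left].
  - have [BB'|B'B] := Ac _ _ AB AB'.
      by apply: (cl B' a x y AB'); right => //; exact: BB'.
    by apply: (cl B a x y AB); right => //; exact: B'B.
exists (V `|` A); split=> //.
move=> U' hU' fU' UU'; apply: contrapT => nU'.
have VU' : V `|` U' = U'.
  by apply/seteqP; split=> [x [Vx|//]|x]; [apply: UU'; left|right].
apply: (Amax U'); last by rewrite /P VU'.
split; first by move=> x Ax; apply: UU'; right.
by move=> U'A; apply: nU' => x /U'A; right.
Qed.

End WeakApproximation.

Section Injectivity.
Context {R : realType} (p : \bar R) (hp : (1 <= p)%E).

Lemma norm_seminorm (V : normedModType R) : seminorm (fun u : V => `|u|).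
Proof. by split=> *; [exact: ler_normD|exact: normrZ]. Qed.

Lemma dual_separates (E : normedModType R) (v : E) :
  (forall y : dual_space E, y v = 0) -> v = 0.
Proof.
move=> h; have [phi [lphi phi_le phiv]] := Hahn_Banach v (norm_seminorm E).
have [|y yE] := bounded_scalar_dual (C := 1) lphi.
  by move=> u; rewrite mul1r.
by apply/eqP; rewrite -normr_eq0 -phiv -yE h.
Qed.

(** [f] is uniformly close on bounded sets to some [g] depending on finitely many vectors, and [x]
    is approximated on these vectors by bounded elements of [V], where [f] vanishes. *)
Lemma FBL_weak_vanishing (F : normedModType R) (V : set (dual_space F)) f
    (x : dual_space F) (C : R) :
  FBL p F f -> subspace V -> (forall v, V v -> f v = 0) -> 0 < C ->
  (forall z, `|x z| <= C * polar_seminorm V z) -> f x = 0.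
Proof.
move=> Ff hV fV C0 xC; have hf := FBL_hom Ff.
apply/eqP; rewrite -normr_le0; apply/ler_addgt0Pl => e e0; rewrite addr0.
have e3 : 0 < e / 3 / C by rewrite !divr_gt0.
have [g Lg fg] := FBL_approx hp Ff e3.
have [hg [s gs]] := FVL_lip Lg.
have hfg : pos_homogeneous (f - g) by move=> a u a0; rewrite !fctE hf// hg// mulrBr.
(* The errors at the vectors of [s] add up to at most [e / 3]; the [+ 1] covers an empty [s]. *)
have d0 : 0 < e / 3 / ((size s)%:R + 1) by rewrite !divr_gt0// ltr_wpDl.
have [v [Vv vC xv]] := bipolar_approx hV s C0 xC d0.
have xC' z : `|x z| <= C * `|z|.
  by rewrite (le_trans (xC z))// ler_wpM2l ?(ltW C0)// polar_seminorm_le_norm.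
have h1 := nbd_point hp hfg fg C0 xC'; have h2 := nbd_point hp hfg fg C0 vC.
rewrite !fctE divfK ?gt_eqF// in h1 h2.
rewrite (fV _ Vv) sub0r normrN in h2.
have h3 : `|g x - g v| <= e / 3.
  rewrite (le_trans (gs _ _))// big_seq.
  apply: (@le_trans _ _ (\sum_(z <- s | z \in s) e / 3 / ((size s)%:R + 1))).
    by apply: ler_sum => z /xv.
  rewrite -big_seq big_const_seq count_predT iter_addr_0 -[leLHS]mulr_natr.
  rewrite mulrAC ler_pdivrMr ?ltr_wpDl// ler_wpM2l ?lerDl//; lra.
have -> : f x = (f x - g x) + (g x - g v) + g v by ring.
rewrite (le_trans (ler_normD _ _))//.
have := ler_normD (f x - g x) (g x - g v).
lra.
Qed.

Lemma FBL_vanish_on_adjoint_range (F : completeNormedModType R) (E : normedModType R)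
    (T : {linear F -> E}) (hT : continuous T) f : injective T -> FBL p F f ->
  (forall y, f (adjoint hT y) = 0) -> forall x, f x = 0.
Proof.
move=> Tinj Ff f0.
have hW : subspace (range (adjoint hT)).
  split; first by exists 0 => //; exact: dual_ext.
  by move=> a _ _ [x _ <-] [y _ <-]; exists (a *: x + y) => //; rewrite adjoint_linear.
have fW x : range (adjoint hT) x -> f x = 0 by move=> [y _ <-].
have [V [hV WV fV Vmax]] := maximal_vanishing_subspace hW fW.
pose q := polar_seminorm V.
have qs : seminorm q := polar_seminormP hV.
(* [V1] is a subspace containing [V] on which [f] still vanishes, so maximality gives [V1 = V]. *)
pose V1 := [set x : dual_space F | exists2 C : R, 0 < C & forall z, `|x z| <= C * q z].
have V1V : V1 `<=` V.
  apply: Vmax.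
  - split.
      by exists 1 => // z; rewrite dual0E normr0 mul1r seminorm_ge0.
    move=> a x y [C C0 xC] [D D0 yD]; exists (`|a| * C + D).
      by rewrite ltr_wpDl// mulr_ge0// ltW.
    move=> z; rewrite dualDE dualZE (le_trans (ler_normD _ _))// mulrDl lerD//.
    by rewrite normrM -mulrA ler_wpM2l.
  - by move=> x [C C0 xC]; apply: (FBL_weak_vanishing Ff hV fV C0 xC).
  - move=> v Vv; have [C C0 vC] := dual_bounded v.
    by exists C => //; exact: polar_seminorm_scaled.
pose I : {linear F -> F} := idfun.
(* Duality for the identity map: a functional dominated by a multiple of [q] lies in [V1], hence in
   [V]; if its norm is at most 1 it is then below [q] itself, whence the constant 1. *)
have approx y (e : R) : 0 < e -> exists x, `|x| <= 1 * q y + e /\ q (y - I x) <= e.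
  apply: approx_solvable => //; first exact: norm_seminorm.
  move=> phi N lphi N0 phiN phi1 u.
  have [|x xE] := bounded_scalar_dual (C := 1) lphi.
    by move=> z; rewrite mul1r; exact: phi1.
  rewrite mul1r -xE; apply: polar_seminorm_ub; split.
    apply: V1V; exists (N + 1); first by rewrite ltr_wpDl.
    move=> z; rewrite xE (le_trans (phiN z))// ler_wpM2r ?lerDl//.
    exact: seminorm_ge0.
  by move=> z; rewrite xE; exact: phi1.
have qI (x : F) : q (I x) <= 1 * `|x| by rewrite mul1r; exact: polar_seminorm_le_norm.
(* Injectivity of [T] enters here: a vector with [q z = 0] is annihilated by the range of the
   adjoint, so [T z = 0]. *)
have sep z : q z = 0 -> z = 0.
  move=> qz; apply: Tinj; rewrite linear0; apply: dual_separates => y.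
  have [C C0 yC] := dual_bounded (adjoint hT y).
  have Vy : V (adjoint hT y) by apply: WV; exists y.
  have := polar_seminorm_scaled hV Vy C0 yC z.
  by rewrite -/q qz mulr0 normr_le0 => /eqP.
have norm_le z : `|z| <= q z.
  apply/ler_addgt0Pl => e e0.
  have [x [xle qx]] := exact_solvable qs ler01 qI approx z e0.
  have /eqP := sep _ qx; rewrite subr_eq0 => /eqP zx.
  by rewrite [in leLHS]zx addrC -[q z]mul1r.
move=> x; apply: fV; apply: V1V; have [C C0 xC] := dual_bounded x.
by exists C => // z; rewrite (le_trans (xC z))// ler_wpM2l// ltW.
Qed.

End Injectivity.

(** * Density, and necessity of surjectivity *)

Section OpenMapping.
Context {R : realType}.

(* Banach-Steinhaus turns the pointwise bound into [|phi| <= C |phi o T|]. *)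
Lemma pointwise_bounded_solvable (F E : completeNormedModType R) (T : {linear F -> E}) :
  continuous T ->
  (forall y, exists M : R, forall phi : dual_space E, (forall x, `|phi (T x)| <= `|x|) ->
    `|phi y| <= M) ->
  exists2 C, 0 < C & forall y, exists2 x, T x = y & `|x| <= C * `|y|.
Proof.
move=> hT H.
pose S : set (E -> R^o) := fun phi => exists2 x : dual_space E,
  (forall v, `|x (T v)| <= `|v|) & phi = dual_fun x.
have [||M MP] := @Banach_Steinhauss R E R^o S _ _ 1.
- move=> _ [x _ ->]; split; last exact: dual_scalar.
  have [C C0 xC] := dual_bounded x.
  by move=> s; exists (C * s) => v vs; rewrite (le_trans (xC v))// ler_wpM2l// ltW.
- by move=> y; have [M MP] := H y; exists M => _ [x xT ->]; exact: MP.
pose C := `|M|.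
have C0 : 0 <= C by rewrite normr_ge0.
have bnd (phi : dual_space E) : (forall x, `|phi (T x)| <= `|x|) ->
    forall y, `|phi y| <= C * `|y|.
  move=> phiT y; have [->|y0] := eqVneq y 0.
    by rewrite (scalar0 (dual_scalar _)) !normr0 mulr0.
  have ny : 0 < `|y| by rewrite normr_gt0.
  have Sphi : S (dual_fun phi) by exists phi.
  have := MP _ Sphi (`|y|^-1 *: y); rewrite normrZ normfV normr_id mulVf ?gt_eqF//.
  move=> /(_ (lexx _)); rewrite (scalarZr (dual_scalar _)) normrM normfV normr_id mulrC.
  by rewrite ler_pdivrMr// => /le_trans; apply; rewrite ler_wpM2r// ler_norm.
have [T' T'0 TT'] : exists2 C, 0 < C & forall v, `|T v| <= C * `|v|.
  have /linear_boundedP/pinfty_ex_gt0[K K0 h] : bounded_near T (nbhs (0 : F)).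
    exact: (@continuous_linear_bounded R F E 0 T (hT 0)).
  by exists K.
have approx y (e : R) : 0 < e -> exists x, `|x| <= C * `|y| + e /\ `|y - T x| <= e.
  apply: (approx_solvable (q := fun u => `|u|)); try exact: norm_seminorm.
  move=> phi N lphi N0 phiN phiT z.
  have [x xE] := bounded_scalar_dual lphi phiN.
  by rewrite -xE; apply: bnd => v; rewrite xE.
exists (C + 1); first by rewrite ltr_wpDl.
move=> y; have [->|y0] := eqVneq y 0.
  by exists 0; rewrite ?linear0// !normr0 mulr0.
have ny : 0 < `|y| by rewrite normr_gt0.
(* The slack is taken to be [|y|], which turns the constant [C] into [C + 1]. *)
have [x [xy /eqP]] := exact_solvable (norm_seminorm E) C0 TT' approx y ny.
rewrite normr_eq0 subr_eq0 => /eqP yx; exists x => //.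
by rewrite mulrDl mul1r.
Qed.

(** The open mapping theorem: any preimage [x] of [y] supplies the pointwise bound
    [|phi y| <= |x|]. *)
Lemma surjective_solvable (F E : completeNormedModType R) (T : {linear F -> E}) :
  continuous T -> (forall y, exists x, T x = y) ->
  exists2 C, 0 < C & forall y, exists2 x, T x = y & `|x| <= C * `|y|.
Proof.
move=> hT Ts; apply: pointwise_bounded_solvable => // y.
by have [x <-] := Ts y; exists `|x| => phi; exact.
Qed.

End OpenMapping.

(** * Injectivity, density, and the necessity of surjectivity *)

Section Parts.
Context {R : realType} (p : \bar R) (hp : (1 <= p)%E).
Context {F E : completeNormedModType R} (T : {linear F -> E}) (hT : continuous T).
Context (Tbar : (dual_space F -> R) -> (dual_space E -> R)).
Context (hTbar : lattice_hom (FBL p F) (FBL p E) Tbar).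
Context (hTbar_delta : forall x : F, Tbar (delta x) = delta (T x)).

Let TbarE := @lattice_hom_adjoint R p hp F E T hT Tbar hTbar hTbar_delta.

Let FBL_delta (G : normedModType R) (v : G) : FBL p G (delta v).
Proof. by apply: (FVL_sub_FBL hp); exact: FVL_delta. Qed.

Lemma Tbar_injective : injective T <-> set_inj (FBL p F) Tbar.
Proof.
split=> [Tinj f g /set_mem Ff /set_mem Fg fg|Tbarinj x y xy].
  apply/funext => x; apply/eqP; rewrite -subr_eq0; apply/eqP.
  have Ffg : FBL p F (f - g) := sublatticeB (FBL_sublattice hp) Ff Fg.
  have fg0 y : (f - g) (adjoint hT y) = 0 by rewrite !fctE -!TbarE// fg subrr.
  exact: (FBL_vanish_on_adjoint_range hp Tinj Ffg fg0 x).
have dxy : delta x = delta y.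
  by apply: Tbarinj; rewrite ?inE; [exact: FBL_delta..|rewrite !hTbar_delta xy].
apply/eqP; rewrite -subr_eq0; apply/eqP; apply: dual_separates => z.
rewrite (scalarB (dual_scalar _)); apply/eqP; rewrite subr_eq0; apply/eqP.
by have := congr1 (fun f => f z) dxy.
Qed.

Lemma lattice_hom_image_sublattice : sublattice (Tbar @` FBL p F).
Proof.
have S := FBL_sublattice (E := F) hp.
split.
- exists 0; first exact: (sublattice0 S).
  apply/funext => y; rewrite TbarE//; exact: (sublattice0 S).
- move=> a _ _ [f Ff <-] [g Fg <-]; exists (a *: f + g).
    exact: (sublattice_lin S).
  exact: (lattice_hom_linear hTbar).
- move=> _ _ [f Ff <-] [g Fg <-]; exists (f \max g); first exact: (sublattice_max S).
  exact: (lattice_hom_max hTbar).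
- move=> _ _ [f Ff <-] [g Fg <-]; exists (f \min g); first exact: (sublattice_min S).
  exact: (lattice_hom_min hTbar).
Qed.

Lemma Tbar_dense : dense (range T) <-> FBL p E `<=` fbl_closure p (Tbar @` FBL p F).
Proof.
split=> [Td|Tbard].
  have sub : FVL E `<=` fbl_closure p (Tbar @` FBL p F).
    apply: smallest_sub.
      exact: (fbl_closure_sublattice hp lattice_hom_image_sublattice).
    move=> _ [y _ <-]; apply/(fbl_closureP hp); split; first by [].
      by exists `|y|; exact: nbd_delta.
    move=> e e0.
    have [w [xy [x _ xw]]] : ball y e `&` range T !=set0.
      by apply: Td; [exists y; exact: ballxx|exact: ball_open].
    exists (Tbar (delta x)); first by exists (delta x).
    have xy' : `|y - T x| <= e by move: xy; rewrite -xw -ball_normE => /ltW.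
    apply: (nbd_le xy'); rewrite hTbar_delta.
    apply: nbd_ext (nbd_delta hp (y - T x)) => z.
    by rewrite !fctE /delta (scalarB (dual_scalar z)).
  move=> f Ff; apply/(fbl_closureP hp); split; [exact: FBL_hom Ff|exact: FBL_nbd Ff|].
  move=> e e0; have e2 : 0 < e / 2 by rewrite divr_gt0.
  have [g /sub/(fbl_closureP hp)[_ _ gA] fg] := FBL_approx hp Ff e2.
  have [h Ah gh] := gA _ e2; exists h => //.
  rewrite [e]splitr; have -> : f - h = (f - g) + (g - h) by rewrite addrA subrK.
  exact: nbdD.
apply: contrapT => nd.
have [y [d [d0 yd]]] : exists y (d : R), 0 < d /\ forall x, d <= `|y - T x|.
  apply: contrapT => H; apply: nd => O [y Oy] oO.
  have [d /= d0 dO] : exists2 d : R, 0 < d & ball y d `<=` O.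
    by have /nbhs_ballP := open_nbhs_nbhs (conj oO Oy).
  apply: contrapT => OT; apply: H; exists y, d; split=> // x.
  rewrite leNgt; apply/negP => yx; apply: OT; exists (T x); split; last by exists x.
  by apply: dO; rewrite -ball_normE.
(* With the zero seminorm on [F] the convolution is the distance to the range of [T]; a functional
   norming [y] for it vanishes on that range and is at least [d] at [y]. *)
have s0 : seminorm (fun _ : F => 0 : R) by split=> *; rewrite ?addr0 ?mulr0.
have sE := norm_seminorm E.
have [phi [lphi phi_le phiy]] := Hahn_Banach y (infconv_seminorm T s0 sE).
have [|z zE] := bounded_scalar_dual (C := 1) lphi.
  move=> v; rewrite mul1r (le_trans (phi_le v))//.
  by have := infconv_le T s0 sE v 0; rewrite add0r linear0 subr0.
have z0 : adjoint hT z = 0.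
  apply: dual_ext => x; rewrite adjointE zE dual0E; apply/eqP; rewrite -normr_le0.
  rewrite (le_trans (phi_le _))//.
  by have := infconv_le T s0 sE (T x) x; rewrite subrr normr0 addr0.
have zy : d <= z y.
  rewrite zE phiy; apply: lb_le_inf; last by move=> _ [x _ <-]; rewrite add0r.
  by exists (0 + `|y - T 0|), 0.
have z1 v : `|z v| <= 1 * `|v|.
  rewrite mul1r zE (le_trans (phi_le v))//.
  by have := infconv_le T s0 sE v 0; rewrite add0r linear0 subr0.
have /Tbard/(fbl_closureP hp)[_ _] := FBL_delta y.
have d2 : 0 < d / 2 by rewrite divr_gt0.
move=> /(_ _ d2)[_ [f Ff <-]] fy.
have hom : pos_homogeneous (delta y - Tbar f).
  have := FBL_hom (lattice_hom_fun hTbar Ff) => h a x a0.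
  by rewrite !fctE h// mulrBr.
(* Every [Tbar f] vanishes at [z], since the adjoint sends [z] to 0, whereas [delta y] is at least
   [d] there. *)
have := nbd_point hp hom fy ltr01 z1.
rewrite !fctE TbarE// z0 (pos_homogeneous0 (FBL_hom Ff)) subr0 mulr1 /delta.
by have := ler_norm (z y); lra.
Qed.

(** If [Tbar f = delta y], then [phi y] is the value of [f] at the adjoint of [phi], so the norm of
    [f] bounds [phi y] for all [phi] whose composite with [T] has norm at most 1. *)
Lemma Tbar_surjective_only_if :
  set_surj (FBL p F) (FBL p E) Tbar -> set_surj setT setT T.
Proof.
move=> Tbars y _.
have [|C _ CP] := @pointwise_bounded_solvable R F E T hT; last first.
  by have [x xy _] := CP y; exists x.
move=> {}y; have [f Ff fy] := Tbars _ (FBL_delta y).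
have [c fc] := FBL_nbd hp Ff.
exists c => phi phiT.
have -> : phi y = f (adjoint hT phi) by rewrite -TbarE// fy.
rewrite -[c]mulr1; apply: (nbd_point hp (FBL_hom Ff) fc) => // v.
by rewrite mul1r adjointE.
Qed.

End Parts.

(** * Weak cluster points from Tychonoff's theorem *)

Section Compactness.
Context {R : realType}.

(** [l] is a cluster point, in a product of compact intervals, of the filter with base [B]; indexing
    by lists makes concatenation refine both sets. *)
Lemma finite_cluster (Y J : Type) (I : eqType) (ev : Y -> I -> R) (b : I -> R)
    (B : seq J -> set Y) :
  (forall s, B s !=set0) -> (forall s t, B (s ++ t) `<=` B s `&` B t) ->
  (forall y i, B [::] y -> `|ev y i| <= b i) ->
  exists l : I -> R, forall s (t : seq I) (e : R), 0 < e ->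
    exists2 y, B s y & forall i, i \in t -> `|ev y i - l i| <= e.
Proof.
move=> B0 BD Bb.
pose K : I -> topologicalType := fun=> (R : topologicalType).
pose A := [set f : forall i, K i | forall i, `[- b i, b i]%classic (f i)].
have cA : compact (A : set (prod_topology K)).
  exact: (@tychonoff I K (fun i => `[- b i, b i]%classic)
    (fun i => @segment_compact R _ _)).
pose Phi : set_system (prod_topology K) := (ev : Y -> prod_topology K) @ filter_from setT B.
have PhiF : ProperFilter Phi.
  apply: fmap_proper_filter; apply: filter_from_proper; last by move=> s _; exact: B0.
  apply: filter_from_filter; first by exists [::].
  by move=> s t _ _; exists (s ++ t) => //; exact: BD.
have PhiA : Phi A.
  by exists [::] => // y By i; rewrite /= in_itv/= -ler_norml; exact: Bb.
have [l [_ lc]] := cA Phi PhiF PhiA.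
exists l => s t e e0.
have PhiB : Phi (ev @` B s) by exists s => // y By; exists y.
have nl : nbhs l [set f : prod_topology K |
    forall i, i \in t -> `|f i - l i| <= e].
  elim: t => [|i t IH]; first by apply: filterS filterT => f _ i; rewrite in_nil.
  have ni : nbhs l [set f : prod_topology K | `|f i - l i| <= e].
    have near_li : nbhs (l i : R) [set a : R | `|a - l i| <= e].
      apply/nbhs_ballP; exists e => // a.
      by rewrite -ball_normE /ball_/= distrC => /ltW.
    exact: (@proj_continuous I K i l _ near_li).
  apply: filterS (filterI ni IH) => f [fi ft] j.
  by rewrite inE => /predU1P[->|/ft].
have [_ [[y By <-] yl]] := lc _ _ PhiB nl.
by exists y.
Qed.

End Compactness.

(** * Merging tuples of functionals *)

Section Merging.
Context {R : realType} (r : R) (r1 : 1 <= r) {E : normedModType R}.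
Implicit Types (x : dual_space E) (s : seq E).

Let r0 : 0 < r. Proof. exact: lt_le_trans r1. Qed.
Let rn0 : r != 0. Proof. by rewrite gt_eqF. Qed.

Definition size_along s x : R := \sum_(v <- s) `|x v|.

Lemma size_along_ge0 s x : 0 <= size_along s x.
Proof. by apply: sumr_ge0. Qed.

Lemma size_along_coord s x v : v \in s -> `|x v| <= size_along s x.
Proof.
by move=> vs; rewrite /size_along (big_rem v)//= lerDl; apply: sumr_ge0.
Qed.

Lemma lpn_size_along s (n : nat) (x : 'I_n -> dual_space E) :
  (forall v, \sum_(k < n) `|x k v| `^ r <= `|v| `^ r) ->
  lpn r (fun k => size_along s (x k)) <= \sum_(v <- s) `|v|.
Proof.
move=> xw; apply: (le_trans (lpn_sum r1 s (fun v k => `|x k v|))).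
apply: ler_sum => v _; rewrite lpn_leP//.
by under eq_bigr do rewrite normr_id.
Qed.

(* Cells are products of intervals of length [1 / N] in the cube [[-1, 1]^s]
   containing the normalised coordinates [x v / size_along s x]. *)
Lemma finite_direction_cells s (e : R) : 0 < e ->
  exists (J : finType) (c : dual_space E -> J), forall x y, c x = c y ->
    0 < size_along s x -> 0 < size_along s y ->
    \sum_(v <- s) `|x v / size_along s x - y v / size_along s y| <= e.
Proof.
move=> e0; pose m := size s.
pose N := (Num.truncn ((m%:R : R) / e)).+1.
have N0 : 0 < N%:R :> R by rewrite ltr0n.
have meN : m%:R / e < N%:R :> R by exact: truncnS_gt.
pose coord x (v : E) : R := (x v / size_along s x + 1) * N%:R.
pose c x : {ffun 'I_m -> 'I_(2 * N).+1} := [ffun i : 'I_m => inord (Num.truncn (coord x (nth 0 s i)))].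
exists {ffun 'I_m -> 'I_(2 * N).+1}, c => x y cxy Sx Sy.
have coordP z v : 0 < size_along s z -> v \in s -> 0 <= coord z v <= (2 * N)%:R.
  move=> Sz vs.
  have : `|z v / size_along s z| <= 1.
    by rewrite normrM normfV (gtr0_norm Sz) ler_pdivrMr// mul1r size_along_coord.
  rewrite ler_norml /coord => /andP[a b]; apply/andP; split.
    by rewrite mulr_ge0 ?ler0n//; lra.
  by rewrite natrM ler_wpM2r ?ler0n//; lra.
have close i : (i < m)%N ->
    `|x s`_i / size_along s x - y s`_i / size_along s y| <= N%:R^-1.
  move=> im; have vs : s`_i \in s by exact: mem_nth.
  have /andP[cx0 cx1] := coordP x _ Sx vs; have /andP[cy0 cy1] := coordP y _ Sy vs.
  have tb (a : R) : 0 <= a -> a <= (2 * N)%:R -> (Num.truncn a < (2 * N).+1)%N.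
    move=> a0 aN; rewrite ltnS -(ler_nat R) (le_trans _ aN)//.
    by have /andP[] := truncn_itv a0.
  have := congr1 (fun f : {ffun 'I_m -> 'I_(2 * N).+1} => val (f (Ordinal im))) cxy.
  rewrite !ffunE /= !inordK ?tb// => txy.
  have /andP[x1 x2] := truncn_itv cx0; have /andP[y1 y2] := truncn_itv cy0.
  rewrite txy in x1 x2.
  rewrite -[X in _ <= X]mul1r ler_pdivlMr// -[X in _ * X](gtr0_norm N0) -normrM.
  have -> : (x s`_i / size_along s x - y s`_i / size_along s y) * N%:R =
      coord x s`_i - coord y s`_i by rewrite /coord; ring.
  move: x1 x2 y1 y2; rewrite -natr1 => x1 x2 y1 y2.
  by rewrite ler_norml; apply/andP; split; lra.
rewrite (big_nth 0) big_mkord.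
apply: (@le_trans _ _ (\sum_(i < m) N%:R^-1)).
  by apply: ler_sum => i _; exact: close.
rewrite sumr_const card_ord -[leLHS]mulr_natl.
by rewrite ler_pdivrMr// mulrC -ler_pdivrMr// ltW.
Qed.

Section MergedTuple.
Context (f : dual_space E -> R) (s : seq E).
Hypotheses (hf : pos_homogeneous f) (fs : lipschitz_along s f).
Context (J : finType) (c : dual_space E -> J) (e : R).
Hypothesis e0 : 0 <= e.
Hypothesis cell : forall x y, c x = c y -> 0 < size_along s x -> 0 < size_along s y ->
  \sum_(v <- s) `|x v / size_along s x - y v / size_along s y| <= e.
Context (n : nat) (x : 'I_n -> dual_space E) (K : pred 'I_n).
Hypothesis xw : forall v, \sum_(k < n) `|x k v| `^ r <= `|v| `^ r.
Hypothesis KS : forall k, K k -> 0 < size_along s (x k).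

Let S k := size_along s (x k).
Let w k := S k `^ r.
Let P (j : J) k := K k && (c (x k) == j).
Let W j := \sum_(k | P j k) w k.
Let Sj j := W j `^ r^-1.

(* The functionals of one cell are merged into a single one, with coefficients
   for which Jensen's inequality preserves the weak [r]-sum and for which
   [Sj j ^ r] is the sum of the [S k ^ r] over the cell. *)
Let X j := \sum_(k | P j k) (w k / W j * (Sj j / S k)) *: x k.

Let PK j k : P j k -> 0 < S k.
Proof. by move=> /andP[/KS]. Qed.

Let w_gt0 j k : P j k -> 0 < w k.
Proof. by move=> /PK ?; rewrite powR_gt0. Qed.

Let W_ge0 j : 0 <= W j.
Proof. by apply: sumr_ge0 => k _; exact: powR_ge0. Qed.

Let W_gt0 j k : P j k -> 0 < W j.
Proof.
move=> Pk; rewrite /W (bigD1 k)//= ltr_pwDl//; first exact: (w_gt0 Pk).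
by apply: sumr_ge0 => i _; exact: powR_ge0.
Qed.

Let Sj_ge0 j : 0 <= Sj j. Proof. exact: powR_ge0. Qed.

Let Sj_powR j : Sj j `^ r = W j.
Proof. by rewrite powR_invK. Qed.

Let sum_cells (a : 'I_n -> R) : \sum_j \sum_(k | P j k) a k = \sum_(k | K k) a k.
Proof.
rewrite (partition_big (fun k => c (x k)) xpredT)//=.
Qed.

Let XE j v : X j v = \sum_(k | P j k) (w k / W j * (Sj j / S k)) * x k v.
Proof. by rewrite /X dual_sumE. Qed.

(** In absolute value [X j v] is at most [Sj j] times the [w]-average of [|x k v| / S k] over the
    cell. Jensen's inequality bounds its [r]-th power by the sum of [|x k v| ^ r] over the cell. *)
Let merged_weak v : \sum_j `|X j v| `^ r <= `|v| `^ r.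
Proof.
apply: (@le_trans _ _ (\sum_j \sum_(k | P j k) `|x k v| `^ r)); last first.
  rewrite sum_cells; apply: le_trans (xw v).
  rewrite [leRHS](bigID K)/= lerDl; apply: sumr_ge0 => k _; exact: powR_ge0.
apply: ler_sum => j _.
have [W0|Wn0] := eqVneq (W j) 0.
  have -> : X j v = 0.
    rewrite XE big1// => k Pk; have := W_gt0 Pk.
    by rewrite W0 ltxx.
  by rewrite normr0 powR0//; apply: sumr_ge0 => k _; exact: powR_ge0.
have Wp : 0 < W j by rewrite lt_neqAle eq_sym Wn0 W_ge0.
have Xle : `|X j v| <= Sj j * ((\sum_(k | P j k) (w k * (`|x k v| / S k))) / W j).
  rewrite XE (le_trans (ler_norm_sum _ _ _))// mulr_suml mulr_sumr.
  apply: ler_sum => k Pk; have Sk := PK Pk; have wk := w_gt0 Pk.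
  rewrite normrM ger0_norm; last first.
    by rewrite !mulr_ge0// ?invr_ge0// ltW.
  rewrite [leLHS](_ : _ = Sj j * (w k * (`|x k v| / S k) / W j))//.
  by field; rewrite !gt_eqF.
apply: (le_trans (powR_le r1 (normr_ge0 _) Xle)).
have arg0 : 0 <= (\sum_(k | P j k) w k * (`|x k v| / S k)) / W j.
  rewrite divr_ge0//; apply: sumr_ge0 => k Pk.
  by rewrite mulr_ge0 ?powR_ge0// divr_ge0// ltW// (PK Pk).
rewrite powRM// Sj_powR.
have := @powR_perspective_sum R r r1 _ (P j) w (fun k => w k * (`|x k v| / S k)).
move=> /(_ (fun k Pk => w_gt0 Pk)) h.
apply: (le_trans (h _)).
  by move=> k Pk; rewrite mulr_ge0 ?powR_ge0// divr_ge0// ltW// (PK Pk).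
apply: ler_sum => k Pk; have Sk := PK Pk; have wk := w_gt0 Pk.
have -> : w k * (`|x k v| / S k) / w k = `|x k v| / S k by field; rewrite !gt_eqF.
by rewrite powR_div ?(ltW Sk)// -/(w k) mulrC divfK// gt_eqF.
Qed.

Let lpn_Sj_le : lpn r Sj <= \sum_(v <- s) `|v|.
Proof.
have s0 : 0 <= \sum_(v <- s) `|v| by apply: sumr_ge0.
have := lpn_size_along s xw; rewrite !lpn_leP//; apply: le_trans.
under eq_bigr do rewrite ger0_norm// Sj_powR.
rewrite sum_cells [leRHS](bigID K)/=.
rewrite [leLHS](_ : _ = \sum_(k | K k) `|size_along s (x k)| `^ r).
  by rewrite lerDl; apply: sumr_ge0 => k _; exact: powR_ge0.
by apply: eq_bigr => k _; rewrite ger0_norm ?size_along_ge0.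
Qed.

Let Sj_le j : Sj j <= \sum_(v <- s) `|v|.
Proof.
apply: (le_trans _ lpn_Sj_le); apply: le_trans (lpn_coord r1 Sj j).
exact: ler_norm.
Qed.

Let merged_bound (t : seq E) :
  (forall k, K k -> size_along t (x k) <= size_along s (x k)) ->
  forall j, size_along t (X j) <= \sum_(v <- s) `|v|.
Proof.
move=> ts j; apply: le_trans (Sj_le j).
apply: (@le_trans _ _ (\sum_(k | P j k) (w k / W j * (Sj j / S k)) * size_along t (x k))).
  rewrite /size_along.
  under [leRHS]eq_bigr do rewrite mulr_sumr.
  rewrite exchange_big/=; apply: ler_sum => v _.
  rewrite XE (le_trans (ler_norm_sum _ _ _))//; apply: ler_sum => k Pk.
  rewrite normrM ger0_norm// !mulr_ge0// ?invr_ge0// ?(ltW (w_gt0 Pk))//.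
  exact: ltW (PK Pk).
apply: (@le_trans _ _ (\sum_(k | P j k) (w k / W j * Sj j))).
  apply: ler_sum => k Pk; have Sk := PK Pk; have Wj := W_gt0 Pk.
  rewrite -mulrA ler_wpM2l ?divr_ge0 ?powR_ge0// mulrAC ler_pdivrMr//.
  by rewrite ler_wpM2l// ts//; case/andP: Pk.
rewrite -mulr_suml -mulr_suml -/(W j).
have [W0|Wn0] := eqVneq (W j) 0; first by rewrite W0 !mul0r.
by rewrite divff// mul1r.
Qed.

(** [X j / Sj j] averages the normalised functionals of its cell, so it is [e]-close to each of them
    along [s]. Rescaling gives [valle], and the factors [(S k / Sj j) ^ r] sum to 1 over a nonempty
    cell. *)
Let merged_value : (\sum_(k | K k) `|f (x k)| `^ r) `^ r^-1 <=
  lpn r (fun j => f (X j)) + e * \sum_(v <- s) `|v|.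
Proof.
have valle j k : P j k -> `|f (x k)| <= S k / Sj j * (`|f (X j)| + e * Sj j).
  move=> Pk; have Sk := PK Pk; have Wj := W_gt0 Pk.
  have Sjp : 0 < Sj j by rewrite powR_gt0.
  have fx : f (x k) = S k * f ((S k)^-1 *: x k).
    by rewrite hf ?invr_ge0 ?(ltW Sk)// mulrA divff ?mul1r// gt_eqF.
  have fX : f (X j) = Sj j * f ((Sj j)^-1 *: X j).
    by rewrite hf ?invr_ge0// mulrA divff ?mul1r// gt_eqF.
  have dist : `|f ((S k)^-1 *: x k) - f ((Sj j)^-1 *: X j)| <= e.
    apply: (le_trans (fs _ _)).
    apply: (@le_trans _ _ (\sum_(v <- s) \sum_(i | P j i)
        w i / W j * `|x k v / S k - x i v / S i|)).
      apply: ler_sum => v _.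
      have -> : ((S k)^-1 *: x k) v - ((Sj j)^-1 *: X j) v =
          \sum_(i | P j i) w i / W j * (x k v / S k - x i v / S i).
        rewrite !dualZE XE.
        under [RHS]eq_bigr do rewrite mulrBr.
        rewrite sumrB -mulr_suml -mulr_suml -/(W j) divff ?gt_eqF// mul1r mulrC.
        congr (_ - _); rewrite mulr_sumr; apply: eq_bigr => i Pi.
        by have Si := PK Pi; field; rewrite !gt_eqF.
      rewrite (le_trans (ler_norm_sum _ _ _))//; apply: ler_sum => i Pi.
      by rewrite normrM ger0_norm// divr_ge0// powR_ge0.
    rewrite exchange_big/=.
    apply: (@le_trans _ _ (\sum_(i | P j i) w i / W j * e)).
      apply: ler_sum => i Pi; rewrite -mulr_sumr ler_wpM2l ?divr_ge0 ?powR_ge0//.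
      apply: cell; [|exact: PK Pk|exact: PK Pi].
      by move: Pk Pi => /andP[_ /eqP ->] /andP[_ /eqP ->].
    by rewrite -mulr_suml -mulr_suml -/(W j) divff ?gt_eqF// mul1r.
  have -> : S k / Sj j * (`|f (X j)| + e * Sj j) = S k * (`|f (X j)| / Sj j + e).
    by field; rewrite gt_eqF.
  rewrite {1}fx normrM (gtr0_norm Sk) ler_wpM2l ?(ltW Sk)//.
  rewrite {1}fX normrM (gtr0_norm Sjp) mulrAC divff ?gt_eqF// mul1r.
  have -> : f ((S k)^-1 *: x k) = f ((Sj j)^-1 *: X j) +
     (f ((S k)^-1 *: x k) - f ((Sj j)^-1 *: X j)) by ring.
  by rewrite (le_trans (ler_normD _ _))// lerD2l.
apply: (@le_trans _ _ (lpn r (fun j => `|f (X j)| + e * Sj j))).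
  rewrite lpnE; apply: powR_inv_le => //.
    by apply: sumr_ge0 => k _; exact: powR_ge0.
  rewrite -sum_cells; apply: ler_sum => j _.
  have [W0|Wn0] := eqVneq (W j) 0.
    rewrite big1 ?powR_ge0// => k Pk; have := W_gt0 Pk.
    by rewrite W0 ltxx.
  have Wp : 0 < W j by rewrite lt_neqAle eq_sym Wn0 W_ge0.
  have Sjp : 0 < Sj j by rewrite powR_gt0.
  have b0 : 0 <= `|f (X j)| + e * Sj j by rewrite addr_ge0// mulr_ge0.
  rewrite (ger0_norm b0).
  apply: (@le_trans _ _ (\sum_(k | P j k) (w k / W j) * (`|f (X j)| + e * Sj j) `^ r)).
    apply: ler_sum => k Pk; have Sk := PK Pk.
    apply: (le_trans (powR_le r1 (normr_ge0 _) (valle _ _ Pk))).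
    by rewrite powRM ?divr_ge0 ?(ltW Sk)// powR_div ?(ltW Sk)// Sj_powR.
  by rewrite -mulr_suml -mulr_suml -/(W j) divff// mul1r.
apply: (le_trans (lpnD r1 _ _)); rewrite lerD//.
  by apply: (ler_lpn r1) => j; rewrite normr_id.
by rewrite (lpnZ r1) ger0_norm// ler_wpM2l.
Qed.

Lemma merged_tuple (t : seq E) :
  (forall k, K k -> size_along t (x k) <= size_along s (x k)) ->
  exists y : J -> dual_space E, [/\ forall v, \sum_j `|y j v| `^ r <= `|v| `^ r,
    forall j, size_along t (y j) <= \sum_(v <- s) `|v| &
    (\sum_(k | K k) `|f (x k)| `^ r) `^ r^-1 <=
      lpn r (fun j => f (y j)) + e * \sum_(v <- s) `|v|].
Proof.
move=> ts; exists X; split; [exact: merged_weak|exact: merged_bound|exact: merged_value].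
Qed.

End MergedTuple.
End Merging.

(** * Lifting along a surjection *)

Section Lifting.
Context {R : realType} (p : \bar R) (hp : (1 <= p)%E).
Let r1 := expo_ge1 hp.
Local Notation r := (expo p).

Section BoundedLength.
Context {F : normedModType R}.
Implicit Types (f : dual_space F -> R) (s t : seq F).

(** The point is that [M] is chosen before [t], [g] and [a]: for finite [p] it is the number of
    direction cells for [s] and [e]. A fixed length is what allows a later compactness argument over
    all [t]. *)
Lemma bounded_length f s (e : R) : pos_homogeneous f -> lipschitz_along s f -> 0 < e ->
  exists2 M, lens p M & forall t (g : dual_space F -> R) (a : R),
    (forall x, `|g x| <= `|f x|) ->
    (forall x, `|f x| <= size_along t x -> g x = 0) -> 0 <= a -> ~ nbd p a g ->
  exists x : 'I_M -> dual_space F, [/\ forall v, \sum_k `|x k v| `^ r <= `|v| `^ r,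
    forall k, size_along t (x k) <= \sum_(v <- s) `|v| &
    a <= lpn r (fun k => f (x k)) + e].
Proof.
move=> hf fs e0; have fle := lipschitz_along_le hf fs.
pose D := \sum_(v <- s) `|v|.
have D0 : 0 <= D by apply: sumr_ge0.
have not_nbd (a : R) g : ~ nbd p a g ->
    exists n (x : 'I_n -> dual_space F), adm p x /\ a < lpn r (fun k => g (x k)).
  move=> ng; apply: contrapT => H; apply: ng => n x ax; rewrite leNgt; apply/negP => ax'.
  by apply: H; exists n, x.
have [J [c cP]] : exists (J : finType) (c : dual_space F -> J), forall x y, c x = c y ->
    0 < size_along s x -> 0 < size_along s y ->
    \sum_(v <- s) `|x v / size_along s x - y v / size_along s y| <= e / (D + 1).
  by apply: finite_direction_cells; rewrite divr_gt0// ltr_wpDl.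
have eD : e / (D + 1) * D <= e.
  rewrite mulrAC ler_pdivrMr ?ltr_wpDl// ler_wpM2l ?(ltW e0)//.
  by rewrite lerDl.
have pcase : (p = +oo%E) \/ lens p = setT.
  by case: p hp => [q _|_|//]; [right|left].
case: pcase => [poo|pfin]; last first.
  exists #|J|; first by rewrite pfin.
  move=> t g a gf g0 a0 /not_nbd[n [x [[_ xw] ax]]].
  (* Outside [K] the function [g] vanishes, so only these functionals are merged. *)
  pose K (k : 'I_n) := size_along t (x k) < `|f (x k)|.
  have KS k : K k -> 0 < size_along s (x k).
    move=> Kk; apply: le_lt_trans (size_along_ge0 t (x k)) _.
    exact: lt_le_trans Kk (fle _).
  have ts k : K k -> size_along t (x k) <= size_along s (x k).
    by move=> Kk; apply: ltW; exact: lt_le_trans Kk (fle _).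
  have e'0 : 0 <= e / (D + 1) by rewrite divr_ge0 ?(ltW e0)// addr_ge0.
  have [y [yw yt yv]] := merged_tuple r1 hf fs e'0 cP xw KS ts.
  have reidx (G : J -> R) : \sum_j G j = \sum_(i < #|J|) G (enum_val i).
    by rewrite -(big_enum_val (A := J) G); apply: eq_bigl => j; rewrite inE.
  exists (fun i => y (enum_val i)); split.
  - by move=> v; rewrite -(reidx (fun j => `|y j v| `^ r)).
  - by move=> i; exact: yt.
  have -> : lpn r (fun i : 'I_#|J| => f (y (enum_val i))) = lpn r (fun j => f (y j)).
    by rewrite !lpnE (reidx (fun j => `|f (y j)| `^ r)).
  apply: (le_trans (ltW ax)); apply: (@le_trans _ _ _ _ _ _ (le_trans yv _)); last first.
    by rewrite lerD2l -/D.
  rewrite lpnE; apply: powR_inv_le => //; first by apply: sumr_ge0 => k _; exact: powR_ge0.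
  rewrite (bigID K)/= [X in _ + X]big1 ?addr0.
    by apply: ler_sum => k _; exact: powR_le.
  move=> k nK; rewrite g0 ?normr0 ?powR0 ?gt_eqF ?(lt_le_trans _ r1)//.
  by rewrite leNgt.
(* For [p = +oo] tuples already have length 1. The bound along [t] holds because otherwise [g] would
   vanish at the single functional. *)
exists 1%N; first exact: lens1.
move=> t g a gf g0 a0 /not_nbd[n [x [[n1 xw] ax]]].
have {}n1 : n = 1%N by move: n1; rewrite poo.
move: x xw ax; rewrite n1 => x xw ax.
have fg : lpn r (fun k => g (x k)) <= lpn r (fun k => f (x k)).
  by apply: (ler_lpn r1) => k; exact: gf.
exists x; split=> //; last by rewrite (le_trans (ltW ax))// (le_trans fg)// lerDl ltW.
move=> k; have -> : k = ord0 by rewrite ord1.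
have x1 : lpn r (fun k => size_along s (x k)) <= D := lpn_size_along r1 s xw.
rewrite lpn1// ger0_norm ?size_along_ge0// in x1.
rewrite leNgt; apply/negP => Dt.
have gx : g (x ord0) = 0.
  by apply: g0; rewrite (le_trans (fle _))// (le_trans x1)// ltW.
by move: ax; rewrite lpn1// gx normr0 ltNge a0.
Qed.

End BoundedLength.

Section Lift.
Context {F E : completeNormedModType R} (T : {linear F -> E}) (hT : continuous T).
Context (C : R) (C0 : 0 < C).
Hypothesis TC : forall y, exists2 x, T x = y & `|x| <= C * `|y|.

(** Compose [x] with a set-theoretic section of [T] of controlled growth; vanishing on the kernel
    makes the composite linear. *)
Lemma annihilator_factors (x : dual_space F) : (forall v, T v = 0 -> x v = 0) ->
  exists y : dual_space E, x = adjoint hT y.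
Proof.
move=> xker; have /choice[sec secP] : forall y, exists v, T v = y /\ `|v| <= C * `|y|.
  by move=> y; have [v] := TC y; exists v.
have [K K0 xK] := dual_bounded x.
have xsec v w : T v = T w -> x v = x w.
  move=> vw; apply/eqP; rewrite -subr_eq0 -(scalarB (dual_scalar x)) xker//.
  by rewrite linearB vw subrr.
have [||y yE] := @bounded_scalar_dual R E (fun y => x (sec y)) (K * C).
- move=> a u v; rewrite -(dual_scalar x); apply: xsec.
  by rewrite linearP !(secP _).1.
- move=> v; rewrite (le_trans (xK _))// -mulrA ler_wpM2l ?(ltW K0)//.
  exact: (secP v).2.
exists y; apply: dual_ext => v; rewrite adjointE yE; apply: xsec.
by rewrite (secP _).1.
Qed.

Lemma FVL_lift g : FVL E g -> exists2 f, FVL F f & forall y, f (adjoint hT y) = g y.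
Proof.
have : FVL E `<=` [set g | exists2 f, FVL F f & forall y, f (adjoint hT y) = g y]; last exact.
have S := @FVL_sublattice R F.
apply: smallest_sub; last first.
  by move=> _ [y _ <-]; have [v <- _] := TC y; exists (delta v) => //; exact: FVL_delta.
split.
- by exists 0 => //; exact: (sublattice0 S).
- move=> a f1 f2 [g1 L1 E1] [g2 L2 E2]; exists (a *: g1 + g2).
    exact: (sublattice_lin S).
  by move=> y; rewrite !fctE E1 E2.
- move=> f1 f2 [g1 L1 E1] [g2 L2 E2]; exists (g1 \max g2); first exact: (sublattice_max S).
  by move=> y /=; rewrite E1 E2.
- move=> f1 f2 [g1 L1 E1] [g2 L2 E2]; exists (g1 \min g2); first exact: (sublattice_min S).
  by move=> y /=; rewrite E1 E2.
Qed.

(* [|truncation f t| = max (|f| - size_along t) 0] *)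
Definition truncation (f : dual_space F -> R) (t : seq F) : dual_space F -> R :=
  ((f - size_along t) \max 0) + ((f + size_along t) \min 0).

Lemma size_along_FVL (t : seq F) : FVL F (size_along t).
Proof.
have -> : size_along t = \sum_(v <- t) (fun x : dual_space F => `|delta v x|).
  by apply/funext => x; rewrite fct_sumE.
apply: (sublattice_sum FVL_sublattice) => v.
by apply: (sublattice_norm FVL_sublattice); exact: FVL_delta.
Qed.

Lemma truncation_FVL f t : FVL F f -> FVL F (truncation f t).
Proof.
move=> Lf; have S := @FVL_sublattice R F; have Lt := size_along_FVL t.
apply: (sublatticeD S).
  by apply: (sublattice_max S); [exact: (sublatticeB S)|exact: (sublattice0 S)].
by apply: (sublattice_min S); [exact: (sublatticeD S)|exact: (sublattice0 S)].
Qed.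

Lemma truncationE f t x : truncation f t x =
  Num.max (f x - size_along t x) 0 + Num.min (f x + size_along t x) 0.
Proof. by []. Qed.

Lemma truncation_le f t x : `|truncation f t x| <= `|f x|.
Proof.
rewrite truncationE; have t0 := size_along_ge0 t x.
move: (size_along t x) t0 (f x) => h h0 a.
have := ler_norm a; have := ler_norm (- a); rewrite normrN => h1 h2.
by rewrite ler_norml; case: (leP (a - h) 0); case: (leP (a + h) 0) => *;
  apply/andP; split; lra.
Qed.

Lemma truncation_eq0 f t x : `|f x| <= size_along t x -> truncation f t x = 0.
Proof.
rewrite truncationE ler_norml => /andP[h1 h2].
by rewrite max_r ?min_r ?addr0//; lra.
Qed.

Lemma truncation_adjoint f t y : (forall v, v \in t -> T v = 0) ->
  truncation f t (adjoint hT y) = f (adjoint hT y).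
Proof.
move=> tker; rewrite truncationE.
have -> : size_along t (adjoint hT y) = 0.
  rewrite /size_along big_seq big1// => v /tker Tv.
  by rewrite adjointE Tv (scalar0 (dual_scalar y)) normr0.
by rewrite subr0 addr0; case: (leP (f (adjoint hT y)) 0) => h; rewrite ?add0r ?addr0.
Qed.

Lemma FVL_norm_lift g (c e : R) : FVL E g -> nbd p c g -> 0 < e ->
  exists f, [/\ FVL F f, forall y, f (adjoint hT y) = g y & nbd p (C * c + e) f].
Proof.
move=> Lg gc e0; have c0 := nbd_ge0 hp gc.
have [f Lf fg] := FVL_lift Lg; have [hf [s fs]] := FVL_lip Lf.
have e2 : 0 < e / 2 by rewrite divr_gt0.
have [M lM MP] := bounded_length hf fs e2.
apply: contrapT => H.
pose D := \sum_(v <- s) `|v|.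
(* Tuples on which [f] is too large while kernel vectors in [t] see at most [D]. A mere bound
   suffices, since it is applied to all multiples of a kernel vector. *)
pose B (t : seq F) := [set x : 'I_M -> dual_space F |
  [/\ forall v, \sum_k `|x k v| `^ r <= `|v| `^ r,
      forall k v, v \in t -> T v = 0 -> `|x k v| <= D &
      C * c + e <= lpn r (fun k => f (x k)) + e / 2]].
have B0 t : B t !=set0.
  (* Truncating along the kernel vectors of [t] only keeps the function a lift of [g]; by [H] its
     norm is then too large. *)
  pose t' := [seq v <- t | T v == 0].
  have t'ker v : v \in t' -> T v = 0 by rewrite mem_filter => /andP[/eqP].
  have nt : ~ nbd p (C * c + e) (truncation f t').
    move=> h; apply: H; exists (truncation f t'); split=> //.
      exact: truncation_FVL.
    by move=> y; rewrite truncation_adjoint.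
  have Ce : 0 <= C * c + e by rewrite addr_ge0 ?(ltW e0)// mulr_ge0// ltW.
  have [x [xw xt xv]] := MP t' _ _ (truncation_le f t') (@truncation_eq0 f t') Ce nt.
  exists x; split=> // k v vt Tv; apply: le_trans (xt k).
  by apply: size_along_coord; rewrite mem_filter Tv eqxx.
have BD t u : B (t ++ u) `<=` B t `&` B u.
  by move=> x [xw xk xv]; split; split=> // k v vt; apply: xk; rewrite mem_cat vt ?orbT.
have rn0 : r != 0 by rewrite gt_eqF// (lt_le_trans _ r1).
have coord (x : 'I_M -> dual_space F) k v :
    (forall v, \sum_k `|x k v| `^ r <= `|v| `^ r) -> `|x k v| <= `|v|.
  move=> xw; apply: (le_trans (lpn_coord r1 (fun k => x k v) k)).
  by rewrite (lpn_leP r1).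
have [l lP] := @finite_cluster R ('I_M -> dual_space F) F ('I_M * F)%type
  (fun x kv => x kv.1 kv.2) (fun kv => `|kv.2|) B B0 BD
  (fun x kv Bx => coord x kv.1 kv.2 (let: And3 h _ _ := Bx in h)).
have small (a b : R) : 0 <= b -> (forall d, 0 < d -> `|a| <= d * b) -> a = 0.
  move=> b0 h; apply/eqP; rewrite -normr_le0; apply/ler_addgt0Pl => d d0; rewrite addr0.
  have d' : 0 < d / (b + 1) by rewrite divr_gt0// ltr_wpDl.
  rewrite (le_trans (h _ d'))// mulrAC ler_pdivrMr ?ltr_wpDl//.
  by rewrite ler_wpM2l ?(ltW d0)// lerDl.
(* Linearity passes to the cluster point because it involves three coordinates at a time. *)
have lscalar k : scalar (fun v => l (k, v)).
  move=> a u v /=; apply/eqP; rewrite -subr_eq0; apply/eqP.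
  apply: (small _ (1 + `|a| + 1)); first by rewrite !addr_ge0.
  move=> d d0; have [x _ xl] := lP [::] [:: (k, a *: u + v); (k, u); (k, v)] d d0.
  have h1 : `|x k (a *: u + v) - l (k, a *: u + v)| <= d.
    by apply: (xl (k, _)); rewrite !inE eqxx.
  have h2 : `|x k u - l (k, u)| <= d by apply: (xl (k, _)); rewrite !inE eqxx orbT.
  have h3 : `|x k v - l (k, v)| <= d by apply: (xl (k, _)); rewrite !inE eqxx !orbT.
  have -> : l (k, a *: u + v) - (a * l (k, u) + l (k, v)) =
     - (x k (a *: u + v) - l (k, a *: u + v)) + a * (x k u - l (k, u)) + (x k v - l (k, v)).
    by rewrite (dual_scalar (x k)); ring.
  have -> : d * (1 + `|a| + 1) = d + `|a| * d + d by ring.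
  rewrite (le_trans (ler_normD _ _))// lerD//.
  rewrite (le_trans (ler_normD _ _))// lerD//; first by rewrite normrN; exact: h1.
  by rewrite normrM ler_wpM2l//; exact: h2.
have lw v : lpn r (fun k => l (k, v)) <= `|v|.
  apply: (lpn_closed r1) => d d0.
  have [x [xw _ _] xl] := lP [::] [seq (k, v) | k <- enum 'I_M] d d0.
  exists (fun k => x k v); first by rewrite (lpn_leP r1).
  move=> k; rewrite distrC; apply: (xl (k, v)).
  by apply/mapP; exists k => //; rewrite mem_enum.
have lker k v : T v = 0 -> l (k, v) = 0.
  move=> Tv; apply: (small _ (D + 1)).
    by rewrite addr_ge0// sumr_ge0.
  move=> d d0.
  (* At the kernel vector [d^-1 *: v] the limit is at most [D + 1], whatever [d] is, so it must
     vanish at [v]. *)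
  have [x [_ xk _] xl] := lP [:: d^-1 *: v] [:: (k, d^-1 *: v)] 1 ltr01.
  have h1 : `|x k (d^-1 *: v)| <= D.
    by apply: xk; rewrite ?inE// linearZ/= Tv scaler0.
  have h2 : `|x k (d^-1 *: v) - l (k, d^-1 *: v)| <= 1.
    by apply: (xl (k, _)); rewrite inE eqxx.
  have h3 : `|l (k, d^-1 *: v)| <= D + 1.
    have -> : l (k, d^-1 *: v) = x k (d^-1 *: v) - (x k (d^-1 *: v) - l (k, d^-1 *: v)) by ring.
    by rewrite (le_trans (ler_normB _ _))// lerD// h2.
  rewrite (scalarZr (lscalar k)) normrM gtr0_norm ?invr_gt0// in h3.
  by rewrite mulrC -ler_pdivrMr// mulrC.
have /choice[y yP] : forall k, exists y : dual_space E, forall v, l (k, v) = y (T v).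
  move=> k; have [|x xE] := bounded_scalar_dual (C := 1) (lscalar k).
    move=> v; rewrite mul1r; apply: le_trans (lw v).
    exact: (lpn_coord r1 (fun k => l (k, v))).
  have [|y yE] := @annihilator_factors x; first by move=> v Tv; rewrite xE lker.
  by exists y => v; rewrite -xE yE.
(* Each [u] has a preimage of norm at most [C * |u|]; this is the source of the factor [C] in the
   norm of the lift. *)
have yw : adm p (fun k => C^-1 *: y k).
  split=> // u; have [v <- vC] := TC u.
  have := lw v; rewrite (lpn_leP r1)// => h.
  rewrite -(lpn_leP r1 (fun k => (C^-1 *: y k) (T v)))//.
  have -> : lpn r (fun k => (C^-1 *: y k) (T v)) = lpn r (fun k => C^-1 * l (k, v)).
    by apply: lpn_ext => k; rewrite dualZE yP.
  rewrite (lpnZ r1) gtr0_norm ?invr_gt0// mulrC ler_pdivrMr// mulrC.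
  exact: le_trans (lw v) vC.
have hg := (FVL_lip Lg).1.
have gy : lpn r (fun k => f (adjoint hT (y k))) <= C * c.
  have := gc _ _ yw.
  have -> : lpn r (fun k => g (C^-1 *: y k)) = lpn r (fun k => C^-1 * f (adjoint hT (y k))).
    by apply: lpn_ext => k; rewrite hg ?fg// invr_ge0 ltW.
  by rewrite (lpnZ r1) gtr0_norm ?invr_gt0// mulrC ler_pdivrMr// mulrC.
(* The lower bound [C * c + e / 2] for [f] on the tuples in [B] passes to the limit tuple, where
   [gy] bounds it above by [C * c]. *)
suff : C * c + e / 2 <= C * c by lra.
apply: le_trans gy.
pose K := lpn r (fun _ : 'I_M => 1 : R).
apply/ler_addgt0Pl => d d0.
pose d' := d / (K + 1) / ((size s)%:R + 1).
have K0 : 0 <= K by exact: lpn_ge0.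
have dK : 0 < d / (K + 1) by rewrite divr_gt0// ltr_wpDl.
have d'0 : 0 < d' by rewrite divr_gt0// ltr_wpDl.
have [x [_ _ xv] xl] := lP [::] [seq (k, v) | k <- enum 'I_M, v <- s] d' d'0.
have close k : `|f (x k) - f (adjoint hT (y k))| <= d / (K + 1).
  rewrite (le_trans (fs _ _))// big_seq.
  apply: (@le_trans _ _ (\sum_(v <- s | v \in s) d')).
    apply: ler_sum => v vs; rewrite adjointE -yP; apply: (xl (k, v)).
    by apply/allpairsP; exists (k, v); split=> //=; rewrite mem_enum.
  rewrite -big_seq big_const_seq count_predT iter_addr_0 -[leLHS]mulr_natr.
  by rewrite mulrAC ler_pdivrMr ?ltr_wpDl// ler_wpM2l ?lerDl// ltW.
have h1 : lpn r (fun k => f (x k)) <=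
    lpn r (fun k => f (adjoint hT (y k))) + d / (K + 1) * K.
  have -> : lpn r (fun k => f (x k)) = lpn r (fun k => f (adjoint hT (y k)) +
      (f (x k) - f (adjoint hT (y k)))).
    by apply: lpn_ext => k; rewrite addrC subrK.
  rewrite (le_trans (lpnD r1 _ _))// lerD2l.
  apply: (@le_trans _ _ (lpn r (fun _ : 'I_M => d / (K + 1) * 1))).
    by apply: (ler_lpn r1) => k; rewrite mulr1 (gtr0_norm dK).
  by rewrite (lpnZ r1) gtr0_norm.
have h2 : d / (K + 1) * K <= d.
  by rewrite mulrAC ler_pdivrMr ?ltr_wpDl// ler_wpM2l ?lerDl// ltW.
lra.
Qed.

(** Write [g] as a series of differences in the free vector lattice with geometrically small norms,
    lift each term by [FVL_norm_lift], and sum the lifts. *)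
Lemma FBL_lift g : FBL p E g -> exists2 f, FBL p F f & forall y, f (adjoint hT y) = g y.
Proof.
move=> Fg; have hg := FBL_hom Fg.
have e0 n : 0 < (2^-1 : R) ^+ n by rewrite exprn_gt0// invr_gt0.
have /choice[h hP] : forall n, exists h, FVL E h /\ nbd p (2^-1 ^+ n) (g - h).
  by move=> n; have [h] := FBL_approx hp Fg (e0 n); exists h.
have hL n := (hP n).1; have gh n := (hP n).2.
pose d n := if n is m.+1 then h m.+1 - h m else h 0%N.
have dL n : FVL E (d n).
  by case: n => [|n]; [exact: hL|exact: (sublatticeB FVL_sublattice)].
have [c hc] := FBL_nbd hp (FVL_sub_FBL hp (hL 0%N)).
have c0 := nbd_ge0 hp hc.
(* The constant [c] serves the term [h 0], and 4 the differences, whose norms are at most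
   [3 * 2^-(n+1)] at index [n + 1]. *)
have dn n : nbd p ((c + 4) * 2^-1 ^+ n) (d n).
  case: n => [|n].
    by apply: nbd_le hc; rewrite expr0 mulr1 lerDl.
  have k := nbdB hp (gh n) (gh n.+1).
  apply: nbd_le (nbd_ext (g := d n.+1) _ k); last first.
    by move=> y; rewrite /d !fctE; congr (`|_|); ring.
  have := e0 n; rewrite exprS; move: (2^-1 ^+ n) => q q0.
  have : 0 <= c * q by rewrite mulr_ge0// ltW.
  by lra.
have /choice[f fP] : forall n, exists f, [/\ FVL F f, forall y, f (adjoint hT y) = d n y &
    nbd p ((C * (c + 4) + 1) * 2^-1 ^+ n) f].
  move=> n; have [f [Lf fE fn]] := FVL_norm_lift (dL n) (dn n) (e0 n).
  by exists f; split=> //; rewrite mulrDl mul1r -mulrA.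
have fL n : FVL F (f n) by case: (fP n).
have fn n : nbd p ((C * (c + 4) + 1) * 2^-1 ^+ n) (f n) by case: (fP n).
have [u Fu uP] := FBL_series hp fL fn.
exists u => // y.
(* As [d 0] is [h 0], the first [n + 1] terms telescope to [h n]. *)
have sumE n : \sum_(i < n.+1) f i (adjoint hT y) = h n y.
  have -> : \sum_(i < n.+1) f i (adjoint hT y) = \sum_(i < n.+1) d i y.
    by apply: eq_bigr => i _; case: (fP i).
  elim: n => [|n IH]; first by rewrite big_ord1.
  by rewrite big_ord_recr/= IH !fctE addrC subrK.
have cu : h n y @[n --> \oo] --> u (adjoint hT y).
  have -> : (fun n => h n y) = (fun n => \sum_(i < n.+1) f i (adjoint hT y)).
    by apply/funext => n; rewrite sumE.
  have := uP (adjoint hT y).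
  by rewrite -(cvg_shiftS (fun n => \sum_(i < n) f i (adjoint hT y))).
apply: (cvg_unique _ cu) => //.
have [K K0 yK] := dual_bounded y.
apply/cvgrPdist_le => e epos.
apply: filterS (half_pow_small K epos) => n; apply: le_trans.
have hom : pos_homogeneous (g - h n).
  by move=> a z a0; rewrite !fctE hg// (FVL_lip (hL n)).1// mulrBr.
by rewrite mulrC; exact: (nbd_point hp hom (gh n) K0 yK).
Qed.

End Lift.
End Lifting.

Theorem proposition3p2 (R : realType) (p : \bar R) (hp : (1 <= p)%E)
    (F E : completeNormedModType R) (T : {linear F -> E})
    (hT : bounded_near T (nbhs (0 : F)))
    (Tbar : (dual_space F -> R) -> (dual_space E -> R))
    (hTbar : lattice_hom (FBL p F) (FBL p E) Tbar)
    (hTbar_delta : forall x : F, Tbar (delta x) = delta (T x)) :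
  [/\ injective T <-> set_inj (FBL p F) Tbar,
      dense (range T) <-> FBL p E `<=` fbl_closure p (Tbar @` FBL p F) &
      set_surj setT setT T <-> set_surj (FBL p F) (FBL p E) Tbar].
Proof.
have cT : continuous T := bounded_linear_continuous hT.
split; [exact: (Tbar_injective hp cT hTbar hTbar_delta)
       |exact: (Tbar_dense hp cT hTbar hTbar_delta)|].
split=> [Ts g Fg|]; last exact: (Tbar_surjective_only_if hp cT hTbar hTbar_delta).
have [C C0 TC] : exists2 C, 0 < C & forall y, exists2 x, T x = y & `|x| <= C * `|y|.
  by apply: (surjective_solvable cT) => y; have [x _ xy] := Ts y I; exists x.
have [f Ff fE] := FBL_lift hp cT C0 TC Fg.
exists f => //; apply/funext => y.
by rewrite (lattice_hom_adjoint hp cT hTbar hTbar_delta Ff).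
Qed.
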